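(* Let $X$ be a continuum. Then $X$ is a simple closed curve if and only if $\mathcal{NB}(\mathcal{F}_1(X))=\mathcal{F}_1(X)$.
   Context: A continuum is a compact connected metric space; a subcontinuum of $X$ is a non-empty closed connected subset of $X$. $2^X$ denotes the collection of all non-empty closed subsets of $X$, and $\mathcal{F}_1(X)=\{\{x\}: x\in X\}$. A simple closed curve is a space homeomorphic to the unit circle $S^1=\{(x,y)\in\mathbb{R}^2: x^2+y^2=1\}$. For $B\in 2^X\setminus\{X\}$ and $x\in X\setminus B$, $B$ does not block $\{x\}$ if the union of all subcontinua of $X$ that contain $x$ and are contained in $X\setminus B$ is dense in $X$. $\mathcal{NB}(\mathcal{F}_1(X))$ is the collection of all $B\in 2^X\setminus\{X\}$ such that $B$ does not block $\{x\}$ for each $x\in X\setminus B$. *)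

(* Defs.v *)
From mathcomp Require Import all_boot all_order all_algebra.
From mathcomp Require Import all_classical all_reals topology.

Set Implicit Arguments.
Unset Strict Implicit.
Unset Printing Implicit Defensive.

Import numFieldTopology.Exports.

Local Open Scope classical_set_scope.
Local Open Scope ring_scope.

Definition continuum (R : realType) (X : metricType R) : Prop :=
  [/\ [set: X] !=set0, compact [set: X] & connected [set: X]].

Definition subcontinuum (X : topologicalType) (C : set X) : Prop :=
  [/\ C !=set0, closed C & connected C].

Definition homeomorphic (X Y : topologicalType) : Prop :=
  exists (f : X -> Y) (g : Y -> X),
    [/\ cancel f g, cancel g f, continuous f & continuous g].

Definition unit_circle (R : realType) : set (R * R) :=
  [set p | p.1 ^+ 2 + p.2 ^+ 2 = 1].
Arguments unit_circle R : clear implicits.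

(* [set_type] carries the topology induced by the product topology of R * R. *)
Definition simple_closed_curve (R : realType) (X : topologicalType) : Prop :=
  homeomorphic X (set_type (unit_circle R)).

(* 2^X *)
Definition closed_hyperspace (X : topologicalType) : set (set X) :=
  [set B | B !=set0 /\ closed B].
Arguments closed_hyperspace X : clear implicits.

(* F_1(X) *)
Definition singleton_hyperspace (X : topologicalType) : set (set X) :=
  [set [set x] | x in [set: X]].
Arguments singleton_hyperspace X : clear implicits.

Definition not_block (X : topologicalType) (B : set X) (x : X) : Prop :=
  dense (\bigcup_(C in [set C | [/\ subcontinuum C, C x & C `<=` ~` B]]) C).

(* NB(F_1(X)) *)
Definition nonblockers (X : topologicalType) : set (set X) :=
  [set B | (closed_hyperspace X `\ [set: X]) B /\
           forall x, (~` B) x -> not_block B x].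
Arguments nonblockers X : clear implicits.

(* Main.v *)
Require Import Defs.
From mathcomp Require Import all_boot all_order all_algebra.
From mathcomp Require Import all_classical all_reals topology.
From mathcomp Require Import interval_inference normedtype realfun.
From mathcomp Require Import ring lra.

(** Deleting a point [p] from a circle leaves a line, so any two other points
    lie in an arc that misses [p]: points do not block.  A closed set
    containing two points [a <> b] and missing a third one does block: a
    subcontinuum avoiding [a] and [b] stays on one side of the chord through
    them, hence misses the open arc on the other side.  This settles one
    implication ([circle_nonblockers]).

    For the converse one knows that no point blocks, and that a set which
    blocks nothing is a point; in particular a pair [a <> b] always blocks
    somewhere.  With boundary bumping this already gives strong separation
    properties.  A subcontinuum [S] never separates the space
    ([complement_connected]): otherwise take [a] and [b] on the two sides;
    bumping the subcontinua provided by the points joins everything to [S]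
    inside the complement of [{a, b}].  On the other hand two disjoint closed
    sets with nonempty interior always separate the space
    ([complement_two_closed_disconnected]), and two disjoint subcontinua leave
    at most two pieces ([no_three_pieces]), as they do in a circle.

    The real obstacle is to find small subcontinua with nonempty interior, for
    nothing a priori excludes a space, such as an indecomposable one, in which
    these are all large.  A proper one exists by a category argument
    ([proper_fat_subcontinuum]).  Given one, say [M], and an open set [O] away
    from it, suppose that [O] contains none.  Then every [g] in a small open
    set [W] has a point [y] on the compact boundary of [W] which belongs to all
    subcontinua that are neighbourhoods of [g].  A second category argument
    produces one point [x] of [W] which, for all [n], cannot be joined to [M]
    off a ball of radius [1/n] around some such boundary point.  A cluster
    point of these centres cuts [x] off from [M], and therefore blocks
    ([local_fat_subcontinuum]).

    Now fix [x] and consider the points that cannot be separated from [x] by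
    disjoint subcontinua that are neighbourhoods.  They form a set which blocks
    nothing, so [x] is the only one ([neq_separated]).  Consequently every
    [z] off [{a, b}] has a neighbourhood which is a subcontinuum missing [a]
    and [b]; a connected complement of [{a, b}] would then make the pair a
    nonblocker, so each pair splits the space into exactly two connected
    pieces ([pair_splits]).  Comparing the splittings given by [{a, b}],
    [{a, z}] and [{z, b}] shows that in either closed piece each point [z]
    cuts [a] from [b] ([splits_arclike]).

    It remains to see that this property characterizes arcs.  The parts
    [L z] cut off by [z] on the side of [a] form a chain, and the distance from
    a point [q] to [L z] is continuous and antitone in [z].  A weighted sum of
    these distances over a dense sequence of points [q] is strictly monotone,
    which gives a parametrization by the unit interval
    ([arc_parametrization]).  The two closed pieces meet in [{a, b}], and their
    parametrizations glue to a bijection onto the circle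
    ([circle_of_arcs]). *)

Set Implicit Arguments.
Unset Strict Implicit.
Unset Printing Implicit Defensive.

Import Order.TTheory GRing.Theory Num.Theory.
Import numFieldNormedType.Exports.

Local Open Scope classical_set_scope.

(** * Separations of connected sets *)

(** The two sets of the cover need only be disjoint inside [A]: this is how
    connectedness is applied throughout. *)
Lemma connected_open_cover (T : topologicalType) (A U V : set T) :
  connected A -> open U -> open V -> A `<=` U `|` V ->
  A `&` U `&` V = set0 -> A `&` U !=set0 -> A `<=` U.
Proof.
move=> cA oU oV AUV AUV0 AU; suff <- : A `&` U = A by move=> x [].
apply: cA => //; first by exists U.
exists (~` V); first exact: open_closedC.
apply/seteqP; split=> x [Ax H]; split=> //.
  by move=> Vx; have : (A `&` U `&` V) x by []; rewrite AUV0.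
by have [] := AUV _ Ax.
Qed.

Lemma connected_closed_cover (T : topologicalType) (A F G : set T) :
  connected A -> closed F -> closed G -> A `<=` F `|` G ->
  A `&` F `&` G = set0 -> A `&` F !=set0 -> A `<=` F.
Proof.
move=> cA cF cG AFG AFG0 [x [Ax Fx]].
suff : A `<=` ~` G by move=> AG y Ay; have [//|/(AG _ Ay)] := AFG _ Ay.
apply: (@connected_open_cover _ A (~` G) (~` F)) => //; try exact: closed_openC.
- move=> y Ay; have nFG : F y -> G y -> False.
    by move=> Fy Gy; have : (A `&` F `&` G) y by []; rewrite AFG0.
  by have [Fy|Gy] := AFG _ Ay; [left=> Gy|right=> Fy]; exact: nFG.
- by apply/seteqP; split=> // y [[Ay Gy] Fy]; have [] := AFG _ Ay.
- by exists x; split=> // Gx; have : (A `&` F `&` G) x by []; rewrite AFG0.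
Qed.

Lemma disconnectedP (T : topologicalType) (A : set T) : ~ connected A ->
  exists O C : set T, [/\ open O, closed C, A `&` O = A `&` C,
    A `&` O !=set0 & A `\` O !=set0].
Proof.
move=> /existsNP[B /not_implyP[B0 /not_implyP[[O oO BO]]]].
move=> /not_implyP[[C cC BC] nBA].
exists O, C; split => //; [by rewrite -BO|by rewrite -BO|].
apply: contrapT => /nonemptyPn nAO; apply: nBA; rewrite BO.
apply/seteqP; split=> x; first by case.
move=> Ax; split=> //; apply: contrapT => nOx.
by have : (A `\` O) x by []; rewrite nAO.
Qed.

Lemma open_disconnected (T : topologicalType) (A : set T) :
  open A -> ~ connected A ->
  exists U V : set T, [/\ open U, open V, U !=set0 /\ V !=set0,
    U `&` V = set0 & A = U `|` V].
Proof.
move=> oA /disconnectedP[O [C [oO cC OC AO nAO]]].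
exists (A `&` O), (A `&` ~` C); split.
- exact: openI.
- by apply: openI => //; exact: closed_openC.
- split=> //; case: nAO => x [Ax nOx]; exists x; split=> // Cx.
  by have : (A `&` C) x by []; rewrite -OC => -[].
- by rewrite OC; apply/seteqP; split=> // x [[_ Cx] [_ /(_ Cx)]].
- by apply/seteqP; split=> [x Ax|x [[]|[]]//]; rewrite OC;
  have [Cx|Cx] := pselect (C x); [left|right].
Qed.

Lemma closed_disconnected (T : topologicalType) (A : set T) :
  closed A -> ~ connected A ->
  exists F G : set T, [/\ closed F, closed G, F !=set0 /\ G !=set0,
    F `&` G = set0 & A = F `|` G].
Proof.
move=> cA /disconnectedP[O [C [oO cC OC AO nAO]]].
exists (A `&` C), (A `&` ~` O); split.
- exact: closedI.
- by apply: closedI => //; exact: open_closedC.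
- by rewrite -OC; split.
- by rewrite -OC; apply/seteqP; split=> // x [[_ Cx] [_ /(_ Cx)]].
- by apply/seteqP; split=> [x Ax|x [[]|[]]//]; rewrite -OC;
  have [Cx|Cx] := pselect (O x); [left|right].
Qed.

(** * Quasicomponents and boundary bumping *)

Section Quasicomponents.
Context (T : topologicalType).
Hypotheses (hT : hausdorff_space T) (cT : compact [set: T]).

Definition relatively_clopen (A D : set T) :=
  [/\ D `<=` A, closed D & closed (A `\` D)].

Definition quasicomponent (A : set T) (x : T) : set T :=
  [set y | forall D, relatively_clopen A D -> D x -> D y].

(** Relatively clopen sets containing [x] are stable under intersection, so by
    compactness a single one of them already avoids a closed set that their
    intersection avoids. *)
Lemma quasicomponent_separation (A F : set T) (x : T) :
  closed A -> closed F -> A x -> quasicomponent A x `&` F = set0 ->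
  exists D, [/\ relatively_clopen A D, D x & D `&` F = set0].
Proof.
move=> clA clF Ax QF; apply: contrapT => /forallNP noD.
pose G := filter_from [set D | relatively_clopen A D /\ D x] (fun D => D `&` F).
have FG : Filter G.
  apply: filter_from_filter.
    by exists A; split=> //; split=> //; rewrite setDv; exact: closed0.
  move=> D E [[DA cD cAD] Dx] [[EA cE cAE] Ex]; exists (D `&` E).
    split; last by split.
    split; [by move=> y [/DA]|exact: closedI|].
    by rewrite setDIr; exact: closedU.
  by move=> y [[Dy Ey] Fy].
have PG : ProperFilter G.
  split=> // -[D [cD Dx] DF]; apply: (noD D); split=> //.
  by apply/seteqP; split=> // y /DF.
have [y [_ cly]] := cT PG filterT.
suff : (quasicomponent A x `&` F) y by rewrite QF.
have GF : G F.
  exists A => [|y' []//]; split=> //; split=> //.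
  by rewrite setDv; exact: closed0.
split; last first.
  by apply: clF => N Ny; have [z [Fz Nz]] := cly _ _ GF Ny; exists z.
move=> D cD Dx; have [_ clD _] := cD; apply: clD => N Ny.
have GD : G D by exists D => // z [].
by have [z [Dz Nz]] := cly _ _ GD Ny; exists z.
Qed.

(** A separation [F | G] of the quasicomponent extends, by normality, to an
    open [W] around [F] whose frontier avoids the quasicomponent.  Some
    relatively clopen [D] then avoids that frontier too, and [D `&` W] is a
    relatively clopen set containing [F] but nothing of [G]. *)
Lemma quasicomponent_connected (A : set T) (x : T) :
  closed A -> A x -> connected (quasicomponent A x).
Proof.
move=> clA Ax; set Q := quasicomponent A x.
have Qx : Q x by move=> D.
have QA : Q `<=` A.
  move=> y; apply=> //; split=> //; rewrite setDv; exact: closed0.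
have clQ : closed Q.
  move=> y Qy D cD Dx; have [_ clD _] := cD; apply: clD => N Ny.
  by have [z [Qz Nz]] := Qy _ Ny; exists z; split=> //; exact: Qz.
apply: contrapT => /(closed_disconnected clQ).
suff noF F G : closed F -> closed G -> G !=set0 -> F `&` G = set0 ->
    Q = F `|` G -> ~ F x.
  move=> [F [G [cF cG [F0 G0] FG QFG]]]; have := Qx; rewrite QFG => -[].
    exact: (noF F G).
  by apply: (noF G F) => //; rewrite 1?setIC 1?setUC.
move=> cF cG [z Gz] FG QFG Fx.
have /(_ F cF (~` G)) [] := compact_normal hT cT.
  apply/set_nbhsP; exists (~` G); split => //; first exact: closed_openC.
  by apply/disjoints_subset.
move=> B /set_nbhsP[W [oW FW WB]] clBG.
have clWG : closure W `<=` ~` G by apply: subset_trans clBG; exact: closureS.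
have clb : closed (closure W `\` W).
  by apply: closedI; [exact: closed_closure|exact: open_closedC].
have Qb : Q `&` (closure W `\` W) = set0.
  apply/seteqP; split=> // y; rewrite QFG => -[[Fy|Gy] [Wy nWy]].
    by apply: nWy; exact: FW.
  exact: clWG Wy Gy.
have [D [[DA clD clAD] Dx DW]] := quasicomponent_separation clA clb Ax Qb.
have DWE : D `&` W = D `&` closure W.
  apply/seteqP; split=> y [Dy Wy]; split=> //; first exact: subset_closure.
  by apply: contrapT => nWy; have : (D `&` (closure W `\` W)) y by []; rewrite DW.
have Qz : Q z by rewrite QFG; right.
have cDW : relatively_clopen A (D `&` W).
  split; first by move=> y [/DA].
    by rewrite DWE; apply: closedI => //; exact: closed_closure.
  rewrite setDIr; apply: closedU => //; apply: closedI => //; exact: open_closedC.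
have [_ Wz] := Qz _ cDW (conj Dx (FW _ Fx)).
by apply: (clWG z) => //; exact: subset_closure.
Qed.

(** The component of [x] in [K `&` M] must leave [W] if [K] does: otherwise
    some relatively clopen part of [K `&` M] containing [x] lies in the open
    set [W], and is therefore clopen in [K] itself. *)
Lemma boundary_bumping (K M W : set T) (x : T) :
  closed K -> connected K -> closed M -> open W -> W `<=` M -> K x -> M x ->
  ~ (K `<=` W) ->
  exists C, [/\ closed C, connected C, C x, C `<=` K `&` M &
                C `&` (M `\` W) !=set0].
Proof.
move=> clK cK clM oW WM Kx Mx KW.
have clKM : closed (K `&` M) by exact: closedI.
exists (quasicomponent (K `&` M) x); split.
- move=> y Qy D cD Dx; have [_ clD _] := cD; apply: clD => N Ny.
  by have [z [Qz Nz]] := Qy _ Ny; exists z; split=> //; exact: Qz.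
- exact: quasicomponent_connected.
- by move=> D.
- move=> y; apply=> //; split=> //; rewrite setDv; exact: closed0.
- apply: contrapT => /nonemptyPn QMW; apply: KW.
  have clMW : closed (M `\` W) by apply: closedI => //; exact: open_closedC.
  have [D [[DKM clD clKMD] Dx DMW]] :=
    quasicomponent_separation clKM clMW (conj Kx Mx) QMW.
  have DW : D `<=` W.
    move=> y Dy; apply: contrapT => nWy; have [_ My] := DKM _ Dy.
    by have : (D `&` (M `\` W)) y by []; rewrite DMW.
  suff <- : D = K by [].
  apply: cK; [by exists x| |by exists D => //; apply/esym/setIidPr => y /DKM[]].
  exists (W `&` ~` (K `&` M `\` D)).
    by apply: openI => //; exact: closed_openC.
  apply/seteqP; split=> y.
    by move=> Dy; split; [have [] := DKM _ Dy|split; [exact: DW|case]].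
  move=> [Ky [Wy nD]]; apply: contrapT => nDy; apply: nD; split=> //.
  by split=> //; exact: WM.
Qed.

End Quasicomponents.

(** * Subcontinua *)

Lemma subcontinuumU (T : topologicalType) (A B : set T) :
  subcontinuum A -> subcontinuum B -> A `&` B !=set0 -> subcontinuum (A `|` B).
Proof.
move=> [[x Ax] clA cA] [_ clB cB] AB.
by split; [exists x; left|exact: closedU|exact: connectedU].
Qed.

Lemma subcontinuum_closure (T : topologicalType) (A : set T) :
  A !=set0 -> connected A -> subcontinuum (closure A).
Proof.
move=> [x Ax] cA; split; [|exact: closed_closure|exact: connected_closure].
by exists x; exact: subset_closure.
Qed.

Lemma subcontinuum1 (T : topologicalType) (x : T) :
  hausdorff_space T -> subcontinuum [set x].
Proof.
move=> hT; split; [by exists x| |exact: connected1].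
exact/accessible_closed_set1/hausdorff_accessible.
Qed.

Lemma closure_open_disjoint (T : topologicalType) (A U : set T) :
  open U -> A `&` U = set0 -> closure A `&` U = set0.
Proof.
move=> oU AU; apply/seteqP; split=> // x [Ax Ux].
by have [y] := Ax _ (open_nbhs_nbhs (conj oU Ux)); rewrite AU.
Qed.

Lemma setI0_False (T : Type) (A B : set T) x : A `&` B = set0 -> A x -> B x -> False.
Proof. by move=> AB Ax Bx; have : (A `&` B) x by []; rewrite AB. Qed.

(** No connected set inside [U `|` (S1 `|` S2)] joins [S1] to [S2].  The
    closed halves [P] and [Q] are recorded because those obtained from disjoint
    [U]'s can be merged ([sidesU]). *)
Definition sides (T : topologicalType) (S1 S2 U : set T) :=
  exists P Q : set T, [/\ closed P, closed Q, P `&` Q = set0,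
    P `|` Q = U `|` (S1 `|` S2) & S1 `<=` P /\ S2 `<=` Q].

Section Sides.
Context (T : topologicalType).
Hypothesis kT : connected [set: T].

Lemma clopen_setT (A : set T) : open A -> closed A -> A !=set0 -> A = setT.
Proof.
by move=> oA clA A0; apply: kT => //; [exists A|exists A] => //; rewrite setTI.
Qed.

(** In a separation of the union, [S1] and [S2] cannot lie in the same half:
    the other half would be contained in [U], hence clopen in the space. *)
Lemma sides_of_disconnected (S1 S2 U : set T) :
  subcontinuum S1 -> subcontinuum S2 -> open U -> U `&` (S1 `|` S2) = set0 ->
  closed (U `|` (S1 `|` S2)) -> ~ connected (U `|` (S1 `|` S2)) ->
  sides S1 S2 U.
Proof.
move=> [S10 _ c1] [S20 _ c2] oU US clE /(closed_disconnected clE).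
suff main F G : closed F -> closed G -> F !=set0 /\ G !=set0 ->
    F `&` G = set0 -> U `|` (S1 `|` S2) = F `|` G -> S1 `&` F !=set0 ->
    sides S1 S2 U.
  move=> [F [G [cF cG [F0 G0] FG EFG]]]; have [x Sx] := S10.
  have : (F `|` G) x by rewrite -EFG; right; left.
  move=> [Fx|Gx]; first by apply: (main F G) => //; exists x.
  by apply: (main G F); rewrite 1?setIC 1?(setUC G) //; exists x.
move=> cF cG [F0 [g Gg]] FG EFG SF.
have sub S : S `<=` S1 `|` S2 -> S `<=` F `|` G.
  by rewrite -EFG => SS x /SS; right.
have one S : S `&` F `&` G = set0 by rewrite -setIA FG setI0.
have S1F : S1 `<=` F.
  by apply: (connected_closed_cover c1 cF cG) => //; apply: sub; left.
exists F, G; split=> //; split=> // x Sx.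
apply: contrapT => nGx; have Fx : F x by have [] := @sub S2 _ x Sx; [right| |].
have S2F : S2 `<=` F.
  apply: (connected_closed_cover c2 cF cG) => //; last by exists x.
  by apply: sub; right.
have GU : G `<=` U.
  move=> y Gy; have : (F `|` G) y by right.
  rewrite -EFG => -[//|[/S1F|/S2F] Fy]; by have := setI0_False FG Fy Gy.
have GE : G = U `&` ~` F.
  apply/seteqP; split=> y.
    by move=> Gy; split; [exact: GU|move=> Fy; exact: setI0_False FG Fy Gy].
  move=> [Uy nFy]; have : (F `|` G) y by rewrite -EFG; left.
  by case.
have GT : G = setT.
  apply: clopen_setT => //; last by exists g.
  by rewrite GE; apply: openI => //; exact: closed_openC.
by apply: (setI0_False FG Fx); rewrite GT.
Qed.

Lemma sidesU (S1 S2 U V : set T) : S1 `&` S2 = set0 ->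
  U `&` V = set0 -> U `&` (S1 `|` S2) = set0 -> V `&` (S1 `|` S2) = set0 ->
  sides S1 S2 U -> sides S1 S2 V -> sides S1 S2 (U `|` V).
Proof.
move=> S12 UV US VS [P [Q [cP cQ PQ PQE [SP SQ]]]].
move=> [P' [Q' [cP' cQ' PQ' PQE' [SP' SQ']]]].
have cross A B C D U1 U2 : U1 `&` U2 = set0 -> U1 `&` (S1 `|` S2) = set0 ->
    U2 `&` (S1 `|` S2) = set0 -> A `|` B = U1 `|` (S1 `|` S2) ->
    C `|` D = U2 `|` (S1 `|` S2) -> A `&` B = set0 -> C `&` D = set0 ->
    S2 `<=` B -> S1 `<=` C -> A `&` D = set0.
  move=> U12 U1S U2S ABE CDE AB CD SB SC; apply/seteqP; split=> // x [Ax Dx].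
  have : (U1 `|` (S1 `|` S2)) x by rewrite -ABE; left.
  have : (U2 `|` (S1 `|` S2)) x by rewrite -CDE; right.
  move=> [U2x|[/SC Cx|S2x]]; last by have := setI0_False AB Ax (SB _ S2x).
    move=> [U1x|S12x]; first exact: (setI0_False U12 U1x U2x).
    exact: (setI0_False U2S U2x S12x).
  by have := setI0_False CD Cx Dx.
exists (P `|` P'), (Q `|` Q'); split; [exact: closedU|exact: closedU| | |].
- rewrite setIUl !setIUr PQ PQ' (cross P Q P' Q' U V) // set0U.
  by rewrite (cross P' Q' P Q V U) ?setU0 // setIC.
- by rewrite setUACA PQE PQE' setUACA setUid.
- by split=> x Sx; left; [exact: SP|exact: SQ].
Qed.

End Sides.

(** * Baire category and dense sequences in compact metric spaces *)

Section CompactMetric.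
Context (R : realType) (X : metricType R).
Hypothesis cX : compact [set: X].

(** Baire's theorem in the form used for category arguments: countably many
    requirements, each of which can be met by shrinking an open set, are met
    simultaneously at some point. *)
Lemma nested_open (Q : nat -> set X -> Prop) (O0 : set X) :
  open O0 -> O0 !=set0 ->
  (forall n O, open O -> O !=set0 -> O `<=` O0 ->
    exists O', [/\ open O', O' !=set0, O' `<=` O & Q n O']) ->
  exists2 x, O0 x & forall n, exists2 O, O x & Q n O.
Proof.
move=> oO0 O00 step.
pose good O := [/\ open O, O !=set0 & O `<=` O0].
have shrink n O : exists O', good O ->
    [/\ good O', closure O' `<=` O & Q n O'].
  have [[oO On OO0]|nO] := pselect (good O); last by exists O => /nO.
  have [O' [oO' [x O'x] OO' QO']] := step n O oO On OO0.
  have [N Nx clN] := @uniform_regular X x O' (open_nbhs_nbhs (conj oO' O'x)).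
  have oN := @open_interior _ (N : set X).
  have NO' : N° `<=` O'.
    by move=> y /interior_subset Ny; apply: clN; exact: subset_closure.
  have N0 : N° !=set0 by exists x.
  have [O2 [oO2 O20 O2N QO2]] := step n N° oN N0
    (subset_trans NO' (subset_trans OO' OO0)).
  exists O2 => _; split => //.
    by split=> //; apply: subset_trans O2N (subset_trans NO' (subset_trans OO' OO0)).
  apply: subset_trans OO'; apply: subset_trans clN; apply: closureS.
  by apply: subset_trans O2N _; exact: interior_subset.
have [f fP] := choice (fun nO : nat * set X => shrink nO.1 nO.2).
pose F := fix F n := if n is m.+1 then f (m, F m) else O0.
have goodF n : good (F n).
  elim: n => [|n IHn] /=; first by split.
  by have [] := fP (n, F n) IHn.
have FS n : closure (F n.+1) `<=` F n by have [] := fP (n, F n) (goodF n).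
have FQ n : Q n (F n.+1) by have [] := fP (n, F n) (goodF n).
have Fle m n : (m <= n)%N -> F n `<=` F m.
  move=> /subnK <-; elim: (n - m)%N => // k IH x.
  by rewrite addSn => Fx; apply: IH; apply: FS; exact: subset_closure.
pose G := filter_from [set: nat] F.
have PG : ProperFilter G.
  apply: filter_from_proper; last by move=> n _; have [] := goodF n.
  apply: filter_from_filter; first by exists 0%N.
  move=> m n _ _; exists (maxn m n) => // x Fx.
  by split; apply: Fle Fx; [exact: leq_maxl|exact: leq_maxr].
have [x [_ clx]] := cX PG filterT.
have Fx n : F n x.
  by apply: FS => N Nx; have [|y [? ?]] := clx (F n.+1) N _ Nx; [exists n.+1|exists y].
by exists x; [exact: (Fx 0%N)|move=> n; exists (F n.+1)].
Qed.

Lemma closed_ball_avoid (K : set X) (p : X) : closed K -> ~ K p ->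
  exists n : nat, forall x, ball p (n.+1%:R^-1 : R) x -> ~ K x.
Proof.
move=> clK nKp.
have /nbhs_ballP[e /= e0 eK] : nbhs p (~` K).
  by apply: open_nbhs_nbhs; split=> //; exact: closed_openC.
have [n] := ltr_add_invr e0; rewrite add0r => ne; exists n => x px.
by apply: eK; apply: le_ball px; exact: ltW.
Qed.

(** Compactness is applied to the finite sequences of points directed by
    inclusion, along which each point eventually has a close neighbour. *)
Lemma finite_net (e : R) : (0 < e)%R ->
  exists s : seq X, forall x, exists2 y, y \in s & ball y e x.
Proof.
move=> e0.
pose F := filter_from [set: seq X] (fun s0 => [set s : seq X | {subset s0 <= s}]).
have FF : Filter F.
  apply: filter_from_filter; first by exists [::].
  move=> s t _ _; exists (s ++ t) => // u su; split=> x xs; apply: su;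
    by rewrite mem_cat xs ?orbT.
have [|s _ sP] := (iffLR (compact_near_coveringP _) cX) _ F
    (fun (s : seq X) x => exists2 y, y \in s & ball y e x) FF.
  move=> x _; exists (ball x e, [set s : seq X | {subset [:: x] <= s}]).
    by split; [exact: nbhsx_ballx|exists [:: x]].
  by move=> [y s] /= [xy xs]; exists x => //; apply: xs; rewrite inE.
by exists s => x; apply: (sP s).
Qed.

Definition unpair (k : nat) : nat * nat := odflt (0, 0)%N (unpickle k).

Lemma unpairK (nm : nat * nat) : exists k, unpair k = nm.
Proof. by exists (pickle nm); rewrite /unpair pickleK. Qed.

Lemma dense_sequence (x0 : X) :
  exists q : nat -> X, forall O, open O -> O !=set0 -> exists n, O (q n).
Proof.
have /choice[s sP] : forall n : nat, exists s : seq X,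
    forall x, exists2 y, y \in s & ball y (n.+1%:R^-1 : R) x.
  by move=> n; apply: finite_net; rewrite invr_gt0 ltr0n.
exists (fun k => nth x0 (s (unpair k).1) (unpair k).2) => O oO [x Ox].
have /nbhs_ballP[e /= e0 eO] : nbhs x O by exact: open_nbhs_nbhs.
have [n] := ltr_add_invr e0; rewrite add0r => ne.
have [y ys yx] := sP n x.
have [k kE] := unpairK (n, index y (s n)).
exists k; rewrite kE /= nth_index //; apply: eO.
by apply: ball_sym; apply: le_ball yx; exact: ltW.
Qed.

End CompactMetric.

(** * Components of complements of balls *)

Section BallComponent.
Context (R : realType) (X : metricType R).
Implicit Types (m p : X) (n : nat).

Lemma ball_interior (p : X) n : (ball p (n.+1%:R^-1 : R))° p.
Proof. by apply: nbhsx_ballx; rewrite invr_gt0 ltr0n. Qed.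

(** Growing with [n], these components exhaust the points which some
    subcontinuum joins to [m] while avoiding [p]. *)
Definition ball_component (m p : X) (n : nat) : set X :=
  connected_component (~` (ball p (n.+1%:R^-1 : R))°) m.

Lemma ball_component_closed m p n : closed (ball_component m p n).
Proof. by apply: component_closed; apply: open_closedC; exact: open_interior. Qed.

Lemma ball_component_subcontinuum m p n :
  ball_component m p n !=set0 -> subcontinuum (ball_component m p n).
Proof.
move=> C0; split=> //; [exact: ball_component_closed|exact: component_connected].
Qed.

Lemma ball_component_center m p n : ~ ball_component m p n p.
Proof. by move=> /(@connected_component_sub _ _ _ _); apply; exact: ball_interior. Qed.

Lemma ball_component_max m p n (K : set X) : connected K -> K m ->
  (forall x, ball p (n.+1%:R^-1 : R) x -> ~ K x) ->
  K `<=` ball_component m p n.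
Proof.
move=> cK Km pK; apply: connected_component_max => // x Kx.
by move=> /(@interior_subset _ _ _)/pK.
Qed.

End BallComponent.

(** * Continua whose nonblockers are the points *)

Section PointNonblockers.
Context (R : realType) (X : metricType R).
Hypotheses (cX : compact [set: X]) (kX : connected [set: X]).
Hypothesis nondegX : forall p : X, exists x, x <> p.
(** The inclusions of the singletons among the nonblockers, and conversely,
    with density in [not_block] tested on open sets. *)
Hypothesis nb_point : forall (p x : X) (O : set X), x <> p -> open O -> O !=set0 ->
  exists C, [/\ subcontinuum C, C x, ~ C p & C `&` O !=set0].
Hypothesis nb_only_point : forall B : set X, B !=set0 -> closed B -> ~` B !=set0 ->
  (forall x O, ~ B x -> open O -> O !=set0 ->
    exists C, [/\ subcontinuum C, C x, C `<=` ~` B & C `&` O !=set0]) ->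
  exists x, B = [set x].

Let hX : hausdorff_space X := @metric_hausdorff _ X.

Let closed1 (x : X) : closed [set x].
Proof. exact/accessible_closed_set1/hausdorff_accessible. Qed.

Lemma open_avoid (O : set X) (p : X) : open O -> O !=set0 ->
  exists2 y, O y & y <> p.
Proof.
move=> oO O0; have [x xp] := nondegX p.
have [C [_ _ nCp [y [Cy Oy]]]] := nb_point xp oO O0.
by exists y => // yp; apply: nCp; rewrite -yp.
Qed.

Lemma open_avoid2 (O : set X) (a b : X) : open O -> O !=set0 ->
  exists y, [/\ O y, y <> a & y <> b].
Proof.
move=> oO O0; have [z Oz za] := open_avoid a oO O0.
have [||y [Oy ya] yb] := @open_avoid (O `&` ~` [set a]) b.
- by apply: openI => //; exact: closed_openC.
- by exists z.
- by exists y.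
Qed.

Lemma no_nonblocking_pair (a b : X) : a <> b ->
  (exists x, x <> a /\ x <> b) ->
  (forall x O, x <> a -> x <> b -> open O -> O !=set0 ->
    exists C, [/\ subcontinuum C, C x, ~ C a, ~ C b & C `&` O !=set0]) ->
  False.
Proof.
move=> ab [z [za zb]] joinO.
have [x Bx] : exists x, [set a; b] = [set x].
  apply: nb_only_point; [by exists a; left|exact: closedU|by exists z => -[]|].
  move=> x O nBx oO O0.
  have [||C [cC Cx Ca Cb CO]] := joinO x O _ _ oO O0.
  - by move=> xa; apply: nBx; left.
  - by move=> xb; apply: nBx; right.
  by exists C; split=> // y Cy [/= yab|/= yab]; rewrite yab in Cy.
have xa : [set x] a by rewrite -Bx; left.
have xb : [set x] b by rewrite -Bx; right.
by apply: ab; rewrite xa xb.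
Qed.

(** If all points were joined off [a] and [b] to the same subcontinuum [S],
    they would be joined to each other and the pair would not block. *)
Lemma no_joining_subcontinuum (a b : X) (S : set X) :
  a <> b -> subcontinuum S -> ~ S a -> ~ S b ->
  (forall x, x <> a -> x <> b ->
    exists C, [/\ subcontinuum C, C x, ~ C a, ~ C b & C `&` S !=set0]) ->
  False.
Proof.
move=> ab cS Sa Sb joinS; apply: (no_nonblocking_pair ab).
  by have [[s Ss] _ _] := cS; exists s; split=> sab; rewrite sab in Ss.
move=> x O xa xb oO O0.
have [y [Oy ya yb]] := open_avoid2 a b oO O0.
have [C [cC Cx Ca Cb CS]] := joinS x xa xb.
have [C' [cC' Cy Ca' Cb' CS']] := joinS y ya yb.
exists ((C `|` S) `|` C'); split.
- apply: subcontinuumU => //; first exact: subcontinuumU.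
  by have [z [? ?]] := CS'; exists z; split=> //; right.
- by left; left.
- by move=> [[]|].
- by move=> [[]|].
- by exists y; split=> //; right.
Qed.

(** Let [S] separate [a] from [b].  A point off [b]'s side is joined off [a] to
    a point on [b]'s side; the part of that subcontinuum which has not yet
    entered [b]'s side reaches [S] by boundary bumping, and it avoids both [a]
    and [b]. *)
Lemma complement_connected (S : set X) : subcontinuum S -> connected (~` S).
Proof.
move=> cS; have [_ clS _] := cS; apply: contrapT => nS.
have [U [V [oU oV [[a Ua] [b Vb]] UV SUV]]] := open_disconnected (closed_openC clS) nS.
have SU x : S x -> U x -> False.
  by move=> Sx Ux; have : (~` S) x by rewrite SUV; left.
have SV x : S x -> V x -> False.
  by move=> Sx Vx; have : (~` S) x by rewrite SUV; right.
apply: (@no_joining_subcontinuum a b S) => //.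
- by move=> ab; apply: (setI0_False UV Ua); rewrite ab.
- by move/SU; apply.
- by move/SV; apply.
suff main P Q p q : open P -> open Q -> P p -> Q q -> P `&` Q = set0 ->
    ~` S = P `|` Q -> forall x, x <> p -> ~ Q x ->
    exists C, [/\ subcontinuum C, C x, ~ C p, ~ C q & C `&` S !=set0].
  move=> x xa xb; have [Vx|nVx] := pselect (V x); last exact: (main U V).
  have nUx : ~ U x by move=> Ux; exact: setI0_False UV Ux Vx.
  have VU : V `&` U = set0 by rewrite setIC.
  have SVU : ~` S = V `|` U by rewrite setUC.
  have [C [? ? ? ? ?]] := main V U b a oV oU Vb Ua VU SVU x xb nUx.
  by exists C.
move=> oP oQ Pp Qq PQ SPQ x xp nQx.
have SP y : S y -> P y -> False.
  by move=> Sx Ux; have : (~` S) y by rewrite SPQ; left.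
have SQ y : S y -> Q y -> False.
  by move=> Sx Ux; have : (~` S) y by rewrite SPQ; right.
have [K [[K0 clK cK] Kx nKp [y [Ky Qy]]]] := nb_point xp oQ (ex_intro _ q Qq).
have PnQ : P `<=` ~` Q by move=> z Pz Qz; exact: setI0_False PQ Pz Qz.
have KP : ~ (K `<=` P) by move=> /(_ _ Ky) Py; exact: setI0_False PQ Py Qy.
have [C [clC cC Cx CKQ [z [Cz [nQz nPz]]]]] :=
  boundary_bumping hX cX clK cK (open_closedC oQ) oP PnQ Kx nQx KP.
exists C; split=> //.
- by split=> //; exists x.
- by move=> /CKQ[].
- by move=> /CKQ[_]; apply.
- exists z; split=> //; apply: contrapT => nSz.
  have : (P `|` Q) z by rewrite -SPQ.
  by case.
Qed.

(** If the open set [U] between [N] and [M] were connected, its closure would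
    be a subcontinuum avoiding interior points [a] of [N] and [b] of [M].
    Boundary bumping inside [N], and inside [M], joins every other point to the
    frontier, hence to that closure, and the pair [{a, b}] would not block. *)
Lemma complement_two_closed_disconnected (N M : set X) :
  closed N -> closed M -> N `&` M = set0 -> N° !=set0 -> M° !=set0 ->
  ~ connected (~` (N `|` M)).
Proof.
move=> clN clM NM [a Na] [b Mb] cU; set U := ~` (N `|` M) in cU.
have U0 : U !=set0.
  apply: contrapT => /nonemptyPn UE.
  have NMT : N `|` M = setT by rewrite -(setCK (N `|` M)) -/U UE setC0.
  have NE : N = ~` M.
    apply/seteqP; split=> x; first by move=> Nx Mx; exact: setI0_False NM Nx Mx.
    by move=> nMx; have [] : (N `|` M) x by rewrite NMT.
  have NT : N = setT.
    apply: (clopen_setT kX) => //; last by exists a; exact: interior_subset.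
    by rewrite NE; exact: closed_openC.
  have Nb : N b by rewrite NT.
  exact: setI0_False NM Nb (interior_subset Mb).
have oU : open U by apply: closed_openC; exact: closedU.
suff main P Q p q : closed P -> closed Q -> P `&` Q = set0 -> P° p -> Q° q ->
    P `|` Q = N `|` M -> forall x, x <> p -> P x ->
    exists C, [/\ subcontinuum C, C x, ~ C p, ~ C q & C `&` closure U !=set0].
  have ncl P p : P `<=` N `|` M -> P° p -> ~ closure U p.
    move=> PNM Pp /(_ _ (@open_nbhs_nbhs _ _ P° _))[].
      by split=> //; exact: open_interior.
    by move=> y [Uy /(@interior_subset _ _ y) /PNM].
  apply: (@no_joining_subcontinuum a b (closure U)).
  - move=> ab; have Ma : M a by rewrite ab; exact: interior_subset.
    exact: setI0_False NM (interior_subset Na) Ma.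
  - exact: subcontinuum_closure.
  - by apply: (ncl N) => //; left.
  - by apply: (ncl M) => //; right.
  move=> x xa xb; have [[Nx|Mx]|Ux] := pselect ((N `|` M) x).
  - exact: (main N M).
  - have MN : M `&` N = set0 by rewrite setIC.
    have [C [? ? ? ? ?]] :=
      main M N b a clM clN MN Mb Na (setUC M N) x xb Mx.
    by exists C.
  - exists [set x]; split=> //;
      [exact: subcontinuum1|by move=> /esym|by move=> /esym|].
    by exists x; split=> //; exact: subset_closure.
move=> clP clQ PQ Pp Qq PQE x xp Px.
have [K [[K0 clK cK] Kx nKp [y [Ky Uy]]]] := nb_point xp oU U0.
have KP : ~ (K `<=` P°).
  by move=> /(_ _ Ky)/(@interior_subset _ _ _) Py; apply: Uy; rewrite -PQE; left.
have [C [clC cC Cx CKQ [z [Cz [Pz nPz]]]]] :=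
  boundary_bumping hX cX clK cK clP (@open_interior _ _) (@interior_subset _ _)
    Kx Px KP.
exists C; split=> //.
- by split=> //; exists x.
- by move=> /CKQ[].
- by move=> /CKQ[_ Pq]; apply: (setI0_False PQ Pq); exact: interior_subset.
- exists z; split=> //; apply: contrapT => nUz; apply: nPz.
  have nQz : ~ Q z by move=> Qz; exact: setI0_False PQ Pz Qz.
  have : nbhs z (~` closure U `&` ~` Q).
    apply: open_nbhs_nbhs; split; last by split.
    apply: openI; [exact/closed_openC/closed_closure|exact: closed_openC].
  apply: filterS => t [nUt nQt]; apply: contrapT => nPt; apply: nUt.
  apply: subset_closure; rewrite /U -PQE; case=> //.
Qed.

(** The union of [S1], [S2] and one piece cannot be connected, since it would
    be a subcontinuum whose complement consists of the two other pieces.  So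
    every piece fails to join [S1] to [S2], and the space would be
    disconnected. *)
Lemma no_three_pieces (S1 S2 U1 U2 U3 : set X) :
  subcontinuum S1 -> subcontinuum S2 -> S1 `&` S2 = set0 ->
  open U1 -> open U2 -> open U3 -> U1 !=set0 -> U2 !=set0 -> U3 !=set0 ->
  U1 `&` U2 = set0 -> U1 `&` U3 = set0 -> U2 `&` U3 = set0 ->
  ~` (S1 `|` S2) = U1 `|` U2 `|` U3 -> False.
Proof.
move=> c1 c2 S12 o1 o2 o3 n1 n2 n3 U12 U13 U23 SU.
have main U V W : open U -> open V -> open W -> V !=set0 -> W !=set0 ->
    U `&` V = set0 -> U `&` W = set0 -> V `&` W = set0 ->
    ~` (S1 `|` S2) = U `|` V `|` W ->
    U `&` (S1 `|` S2) = set0 /\ sides S1 S2 U.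
  move=> oU oV oW V0 [w Ww] UV UW VW SUE.
  have US : U `&` (S1 `|` S2) = set0.
    apply/disjoints_subset => x Ux; rewrite SUE; by left; left.
  have CE : ~` (U `|` (S1 `|` S2)) = V `|` W.
    rewrite setCU SUE; apply/seteqP; split=> x.
      by move=> [nUx [[|]|]]; [by []|left|right].
    move=> VWx; split; last by case: VWx => ?; [left; right|right].
    by case: VWx => VWx Ux; [exact: setI0_False UV Ux VWx|exact: setI0_False UW Ux VWx].
  have clE : closed (U `|` (S1 `|` S2)) by rewrite -openC CE; exact: openU.
  split=> //; apply: sides_of_disconnected => // cE.
  have : subcontinuum (U `|` (S1 `|` S2)).
    by split=> //; have [[s Ss] _ _] := c1; exists s; right; left.
  move/complement_connected; rewrite CE => cVW.
  have VWV : V `|` W `<=` V.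
    apply: (connected_open_cover cVW oV oW) => //.
      by rewrite -setIA VW setI0.
    by have [v Vv] := V0; exists v; split=> //; left.
  by apply: (setI0_False VW _ Ww); apply: VWV; right.
have [US1 s1] := main U1 U2 U3 o1 o2 o3 n2 n3 U12 U13 U23 SU.
have U21 : U2 `&` U1 = set0 by rewrite setIC.
have U31 : U3 `&` U1 = set0 by rewrite setIC.
have U32 : U3 `&` U2 = set0 by rewrite setIC.
have [US2 s2] := main U2 U1 U3 o2 o1 o3 n1 n3 U21 U23 U13
  (etrans SU (congr1 (setU^~ U3) (setUC U1 U2))).
have SU3 : ~` (S1 `|` S2) = U3 `|` U1 `|` U2 by rewrite SU setUC setUA.
have [US3 s3] := main U3 U1 U2 o3 o1 o2 n1 n2 U31 U32 U12 SU3.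
have s12 := sidesU S12 U12 US1 US2 s1 s2.
have U123 : (U1 `|` U2) `&` U3 = set0 by rewrite setIUl U13 U23 setU0.
have US12 : (U1 `|` U2) `&` (S1 `|` S2) = set0 by rewrite setIUl US1 US2 setU0.
have [P [Q [cP cQ PQ PQE [SP SQ]]]] := sidesU S12 U123 US12 US3 s12 s3.
have PQT : [set: X] `<=` P `|` Q.
  by move=> x _; rewrite PQE -SU; have [|] := pselect ((S1 `|` S2) x); [right|left].
have [[s Ss] _ _] := c1; have [[t St] _ _] := c2.
apply: (setI0_False PQ _ (SQ _ St)).
apply: (connected_closed_cover kX cP cQ PQT) => //; first by rewrite setTI.
by exists s; split=> //; exact: SP.
Qed.

Definition splits (S1 S2 U V : set X) :=
  [/\ open U, open V, U `&` V = set0, ~` (S1 `|` S2) = U `|` V &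
      U !=set0 /\ V !=set0].

Lemma splitsC (S1 S2 U V : set X) : splits S1 S2 U V -> splits S1 S2 V U.
Proof.
by move=> [? ? UV SUV [? ?]]; split=> //; [rewrite setIC|rewrite SUV setUC].
Qed.

Lemma splits_connected (S1 S2 U V : set X) :
  subcontinuum S1 -> subcontinuum S2 -> S1 `&` S2 = set0 ->
  splits S1 S2 U V -> connected U.
Proof.
move=> c1 c2 S12 [oU oV UV SUV [U0 V0]]; apply: contrapT => nU.
have [A [B [oA oB [A0 B0] AB UAB]]] := open_disconnected oU nU.
have [AV BV] : A `&` V = set0 /\ B `&` V = set0.
  by move: UV; rewrite UAB setIUl setU_eq0.
by apply: (@no_three_pieces S1 S2 A B V) => //; rewrite SUV UAB.
Qed.

(** Otherwise [U] would be clopen in the complement of [S2], which is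
    connected. *)
Lemma splits_closure (S1 S2 U V : set X) :
  subcontinuum S1 -> subcontinuum S2 -> S1 `&` S2 = set0 ->
  splits S1 S2 U V -> closure U `&` S1 !=set0.
Proof.
move=> c1 c2 S12 [oU oV UV SUV [[u Uu] V0]].
apply: contrapT => /nonemptyPn clUS1.
have clUV := closure_open_disjoint oV UV.
have US x : U x -> ~ (S1 `|` S2) x.
  by move=> Ux; rewrite -[~ _]/((~` (S1 `|` S2)) x) SUV; left.
have S2U : ~` S2 `<=` U.
  apply: (@connected_open_cover _ _ _ (~` closure U)) => //.
  - exact: complement_connected.
  - exact/closed_openC/closed_closure.
  - move=> x nS2x; have [clUx|] := pselect (closure U x); last by right.
    left; have : (~` (S1 `|` S2)) x.
      by move=> [S1x|//]; exact: setI0_False clUS1 clUx S1x.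
    by rewrite SUV => -[//|Vx]; have := setI0_False clUV clUx Vx.
  - by apply/seteqP; split=> // x [[_ Ux] nUx]; apply: nUx; exact: subset_closure.
  - by exists u; split=> // S2u; apply: (US u Uu); right.
have [[s Ss] _ _] := c1; have [//|] := US s (S2U _ _); last by left.
by move=> S2s; exact: setI0_False S12 Ss S2s.
Qed.

Lemma splits_subcontinuumC (S1 S2 U V : set X) :
  subcontinuum S1 -> subcontinuum S2 -> S1 `&` S2 = set0 ->
  splits S1 S2 U V -> subcontinuum (~` U).
Proof.
move=> c1 c2 S12 sUV; have [oU oV UV SUV [U0 V0]] := sUV.
have sVU := splitsC sUV.
have -> : ~` U = (S1 `|` closure V) `|` S2.
  apply/seteqP; split=> x.
    move=> nUx; have [[S1x|S2x]|nSx] := pselect ((S1 `|` S2) x).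
    - by left; left.
    - by right.
    - left; right; apply: subset_closure.
      by have : (~` (S1 `|` S2)) x by []; rewrite SUV => -[].
  have SU y : (S1 `|` S2) y -> ~ U y.
    move=> Sy Uy; have : (~` (S1 `|` S2)) y by rewrite SUV; left.
    by apply.
  move=> [[S1x|clVx]|S2x].
  - by apply: SU; left.
  - move=> Ux; have VU : V `&` U = set0 by rewrite setIC.
    exact: setI0_False (closure_open_disjoint oU VU) clVx Ux.
  - by apply: SU; right.
have cV : subcontinuum (closure V).
  apply: subcontinuum_closure => //.
  exact: (splits_connected c1 c2 S12 sVU).
have S21 : S2 `&` S1 = set0 by rewrite setIC.
apply: subcontinuumU => //.
  by apply: subcontinuumU => //; rewrite setIC; exact: (splits_closure c1 c2 S12 sVU).
have [|x [Vx Sx]] := @splits_closure S2 S1 V U c2 c1 S21.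
  by have [? ? ? ? ?] := sVU; split=> //; rewrite setUC.
by exists x; split=> //; right.
Qed.

Lemma splits_ex (D H : set X) : subcontinuum D -> subcontinuum H ->
  D `&` H = set0 -> D° !=set0 -> H° !=set0 -> exists U V, splits D H U V.
Proof.
move=> [_ clD _] [_ clH _] DH D0 H0.
have := complement_two_closed_disconnected clD clH DH D0 H0.
move/open_disconnected => []; first by apply: closed_openC; exact: closedU.
by move=> U [V [oU oV UV0 UV E]]; exists U, V.
Qed.

(** * Subcontinua with nonempty interior *)

(** If no proper subcontinuum has interior, then the components of [a] in the
    complements of the balls around a dense sequence are nowhere dense.  A point
    [b0] outside all of them lies with [a] in no proper subcontinuum.  Then
    the pair [{a, b0}] does not block: for a given [x], subcontinua reaching
    [a] off [b0] and [b0] off [a] cannot both exist, because their union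
    would be the whole space and one of them would have interior. *)
Lemma proper_fat_subcontinuum (a b : X) :
  a <> b -> exists C : set X, [/\ subcontinuum C, C° !=set0 & C <> setT].
Proof.
move=> ab; apply: contrapT => noC.
have fat (C : set X) : subcontinuum C -> C° !=set0 -> C = setT.
  by move=> cC C0; apply: contrapT => CT; apply: noC; exists C.
have [q qP] := dense_sequence cX a.
pose K k := connected_component
  (~` (ball (q (unpair k).1) ((unpair k).2.+1%:R^-1 : R))°) a.
have Kfat k : (K k)° = set0.
  apply: contrapT => /eqP/set0P K0.
  have [x Kx] := K0.
  have qK : ~ K k (q (unpair k).1).
    move/(@connected_component_sub _ _ _ _); apply.
    by apply: nbhsx_ballx; rewrite invr_gt0 ltr0n.
  apply: qK; rewrite (fat (K k)) //; split.
  - by exists x; exact: interior_subset.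
  - apply: component_closed; apply: open_closedC; exact: open_interior.
  - exact: component_connected.
have [|||b0 ab0 Kb0] := @nested_open R X cX (fun k O => O `&` K k = set0) (~` [set a]).
- by apply: closed_openC.
- by exists b => /esym.
- move=> k O oO [x Ox] _; exists (O `\` K k); split; last first.
  + by apply/seteqP; split=> // y [[]].
  + by move=> y [].
  + apply: contrapT => /nonemptyPn OK.
    suff : (K k)° x by rewrite Kfat.
    apply: (filterS _ (open_nbhs_nbhs (conj oO Ox))) => y Oy.
    by apply: contrapT => nKy; have : (O `\` K k) y by []; rewrite OK.
  + apply: openI => //; apply: closed_openC; apply: component_closed.
    apply: open_closedC; exact: open_interior.
have irr C : subcontinuum C -> C a -> C b0 -> C = setT.
  move=> [C0 clC cC] Ca Cb; apply: contrapT => CT.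
  have [|n nCq] := qP (~` C) (closed_openC clC).
    by apply: contrapT => /nonemptyPn CE; apply: CT; rewrite -(setCK C) CE setC0.
  have [m mC] := closed_ball_avoid clC nCq.
  have [k kE] := unpairK (n, m).
  have [O Ob OK] := Kb0 k.
  apply: (setI0_False OK Ob); rewrite /K kE /=.
  apply: (@connected_component_max _ _ C) => // y Cy.
  by move=> /(@interior_subset _ _ _) /mC.
have [x [_ xa xb]] := @open_avoid2 setT a b0 openT (ex_intro _ a I).
apply: (@no_nonblocking_pair a b0); first by move=> /esym.
  by exists x.
move=> {xa xb}x O xa xb oO O0.
have [PA|nPA] := pselect (forall C, subcontinuum C -> C x -> ~ C a -> ~ C b0).
  have [C [cC Cx Ca CO]] := nb_point xa oO O0.
  by exists C; split=> //; exact: PA.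
have [PB|nPB] := pselect (forall C, subcontinuum C -> C x -> ~ C b0 -> ~ C a).
  have [C [cC Cx Cb CO]] := nb_point xb oO O0.
  by exists C; split=> //; exact: PB.
exfalso.
have [C [cC Cx nCa Cb]] : exists C, [/\ subcontinuum C, C x, ~ C a & C b0].
  by apply: contrapT => nC; apply: nPA => C cC Cx Ca Cb; apply: nC; exists C.
have [D [cD Dx nDb Da]] : exists D, [/\ subcontinuum D, D x, ~ D b0 & D a].
  by apply: contrapT => nC; apply: nPB => C' cC' Cx' Ca' Cb'; apply: nC; exists C'.
have CDT : C `|` D = setT.
  by apply: irr; [apply: subcontinuumU => //; exists x|right|left].
have DT : D = setT.
  apply: fat => //; exists a; have [_ clC _] := cC.
  apply: (filterS _ (open_nbhs_nbhs (conj (closed_openC clC) nCa))) => y nCy.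
  by have [] : (C `|` D) y by rewrite CDT.
by apply: nDb; rewrite DT.
Qed.

(** A subcontinuum around [g] missing [y] is turned into one around [y] missing
    [g] by taking the closure of its complement; the latter is then connected
    to [M]. *)
Lemma subcontinuum_near (y g : X) (H M : set X) :
  subcontinuum H -> H° g -> ~ H y -> subcontinuum M -> M° !=set0 -> ~ M g ->
  exists L, [/\ subcontinuum L, L° y, ~ L g & M `<=` L].
Proof.
move=> cH Hg nHy cM M0 nMg; have [_ clH _] := cH.
have oH : open (~` H) by exact: closed_openC.
have yg : y <> g by move=> yg; apply: nHy; rewrite yg; exact: interior_subset.
have [C [cC Cy nCg [z [Cz Mz]]]] := nb_point yg (@open_interior _ M) M0.
have cK : subcontinuum (closure (~` H)).
  by apply: subcontinuum_closure; [exists y|exact: complement_connected].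
exists ((closure (~` H) `|` C) `|` M); split.
- apply: subcontinuumU => //.
    by apply: subcontinuumU => //; exists y; split=> //; exact: subset_closure.
  by exists z; split; [right|exact: interior_subset].
- apply: (filterS _ (open_nbhs_nbhs (conj oH nHy))) => x nHx.
  by left; left; exact: subset_closure.
- move=> [[clg|//]|//]; apply: (setI0_False _ clg Hg).
  apply: closure_open_disjoint; first exact: open_interior.
  by apply/seteqP; split=> // x [nHx /(@interior_subset _ _ _)].
- by move=> x Mx; right.
Qed.

(** The claim [key] is the heart: were every boundary point [y] of [W]
    avoided by some subcontinuum around [g], then by compactness of the boundary
    one component [ball_component m0 g n] would contain all of it.  The
    complement of this component, being connected, would be confined to [W], and
    its closure would be a subcontinuum with interior inside [O]. *)
Lemma local_fat_subcontinuum (M O : set X) : subcontinuum M -> M° !=set0 ->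
  open O -> O !=set0 -> O `&` M = set0 ->
  exists N, [/\ subcontinuum N, N° !=set0 & N `<=` O].
Proof.
move=> cM M0 oO [c Oc] OM; apply: contrapT => noN.
have [m0 Mm0] := M0.
have [clM kM] : closed M /\ connected M by have [] := cM.
have [W0 W0c clW0] := @uniform_regular X c O (open_nbhs_nbhs (conj oO Oc)).
pose W := (W0 : set X)°.
have oW : open W := @open_interior _ _.
have Wc : W c by [].
have clWO : closure W `<=` O.
  by apply: subset_trans clW0; apply: closureS; exact: interior_subset.
pose Y := closure W `\` W.
have clY : closed Y.
  by apply: closedI; [exact: closed_closure|exact: open_closedC].
have cY : compact Y by apply: subclosed_compact cX _.
have YM y : Y y -> ~ M y.
  by move=> [/clWO Oy _] My; exact: setI0_False OM Oy My.
have WM y : W y -> ~ M y.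
  by move=> /subset_closure/clWO Oy My; exact: setI0_False OM Oy My.
have key g : W g -> exists2 y, Y y &
    forall H, subcontinuum H -> H° g -> H y.
  move=> Wg; apply: contrapT => noy.
  have cYm : compact (Y `|` [set m0]) by apply: compactU => //; exact: compact_set1.
  have near_in y (Ym : (Y `|` [set m0]) y) :
      \forall y' \near y & n \near \oo, ball_component m0 g n y'.
    have [L [[L0 clL cL] Ly nLg ML]] :
        exists L, [/\ subcontinuum L, L° y, ~ L g & M `<=` L].
      case: Ym => [Yy|->]; last first.
        by exists M; split=> //; exact: WM.
      have [H [cH Hg nHy]] : exists H, [/\ subcontinuum H, H° g & ~ H y].
        apply: contrapT => noH; apply: noy; exists y => // H cH Hg.
        by apply: contrapT => nHy; apply: noH; exists H.
      exact: (subcontinuum_near cH Hg nHy cM M0 (WM _ Wg)).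
    have [n0 n0P] := closed_ball_avoid clL nLg.
    exists (L°, [set n | (n0 <= n)%N]) => /=.
      split; first by apply: open_nbhs_nbhs; split=> //; exact: open_interior.
      exact: nbhs_infty_ge.
    move=> [y' n] /= [/(@interior_subset _ _ _) Ly' n0n].
    apply: (ball_component_max cL _ _ Ly').
      by apply: ML; exact: interior_subset.
    move=> x gx; apply: n0P; apply: le_ball gx.
    by rewrite lef_pV2 ?posrE ?ltr0n // ler_nat.
  have [n _ /(_ n (leqnn n)) YE] := (iffLR (compact_near_coveringP _) cYm)
    _ _ (fun n => ball_component m0 g n) _ near_in.
  have Em : ball_component m0 g n m0 by apply: YE; right.
  have cE : subcontinuum (ball_component m0 g n).
    by apply: ball_component_subcontinuum; exists m0.
  have [_ clE _] := cE.
  have nEg := @ball_component_center R X m0 g n.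
  have EW : ~` ball_component m0 g n `<=` W.
    apply: (@connected_open_cover _ _ _ (~` closure W)) => //.
    - exact: complement_connected.
    - exact/closed_openC/closed_closure.
    - move=> x nEx; have [clWx|] := pselect (closure W x); last by right.
      left; apply: contrapT => nWx; apply: nEx; apply: YE; left; by [].
    - by apply/seteqP; split=> // x [[_ Wx] nWx]; apply: nWx; exact: subset_closure.
    - by exists g.
  apply: noN; exists (closure (~` ball_component m0 g n)); split.
  - by apply: subcontinuum_closure; [exists g|exact: complement_connected].
  - exists g; apply: (filterS _ (open_nbhs_nbhs (conj (closed_openC clE) nEg))).
    exact: subset_closure.
  - by apply: subset_trans clWO; exact: closureS.
(* For each [n] the component of [M] off the ball around the boundary point
   attached to [g] omits an open set arbitrarily close to [g], since it is
   not a neighbourhood of [g]. *)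
have [|||x Wx Qx] := @nested_open R X cX (fun n O' => exists2 p, Y p &
    forall K, subcontinuum K -> M `<=` K ->
      (forall z, ball p (n.+1%:R^-1 : R) z -> ~ K z) -> K `&` O' = set0) W.
- by [].
- by exists c.
- move=> n O1 oO1 [g O1g] O1W.
  have [y Yy yP] := key g (O1W _ O1g).
  exists (O1 `\` ball_component m0 y n); split.
  + apply: openI => //; apply: closed_openC; exact: ball_component_closed.
  + apply: contrapT => /nonemptyPn OE; apply: (@ball_component_center R X m0 y n).
    have OC : O1 `<=` ball_component m0 y n.
      move=> z Oz; apply: contrapT => nEz.
      by have : (O1 `\` ball_component m0 y n) z by []; rewrite OE.
    apply: yP; first by apply: ball_component_subcontinuum; exists g; exact: OC.
    by apply: (filterS _ (open_nbhs_nbhs (conj oO1 O1g))).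
  + by move=> z [].
  + exists y => // K [_ _ cK] MK yK; apply/seteqP; split=> // z [Kz [_ nEz]].
    apply: nEz; apply: (ball_component_max cK _ yK) => //.
    by apply: MK; exact: interior_subset.
have /choice[p pP] : forall n : nat, exists p, Y p /\ forall K, subcontinuum K ->
    M `<=` K -> (forall z, ball p (n.+1%:R^-1 : R) z -> ~ K z) -> ~ K x.
  move=> n; have [O' O'x [p Yp pP]] := Qx n; exists p; split=> // K cK MK pK Kx.
  exact: (setI0_False (pP K cK MK pK) Kx O'x).
(* The cluster point [p0] of the centres cuts [x] off from [M]. *)
have [|p0 [Yp0 clp0]] := cY (p @ \oo) _.
  by exists 0%N => // n _ /=; have [] := pP n.
have xp : x <> p0 by move=> xp; have [_] := Yp0; rewrite -xp.
have [K [cK Kx nKp [z [Kz Mz]]]] := nb_point xp (@open_interior _ M) M0.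
have cL : subcontinuum (K `|` M).
  by apply: subcontinuumU => //; exists z; split=> //; exact: interior_subset.
have [_ clL _] := cL.
have nLp : ~ (K `|` M) p0 by case=> // Mp; exact: (YM _ Yp0 Mp).
have [n0 n0P] := closed_ball_avoid clL nLp.
have e0 : (0 < n0.+1%:R^-1 / 2 :> R)%R by rewrite divr_gt0 // invr_gt0 ltr0n.
have [k] := ltr_add_invr e0; rewrite add0r => ke.
have [||q [[n kn <-] /= pn]] := clp0 (p @` [set n | (k <= n)%N])
  (ball p0 (n0.+1%:R^-1 / 2 : R)%R).
- by exists k => // n /= kn; exists n.
- exact: nbhsx_ballx.
have [_] := pP n; move=> /(_ _ cL); apply; [by right| |by left].
move=> w pw; apply: n0P; rewrite (splitr (n0.+1%:R^-1 : R)%R).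
apply: ball_triangle pn _; apply: le_ball pw.
apply: le_trans (ltW ke).
by rewrite lef_pV2 ?posrE ?ltr0n // ler_nat.
Qed.

Lemma open_fat_subcontinuum (a b : X) (O : set X) : a <> b ->
  open O -> O !=set0 -> exists N, [/\ subcontinuum N, N° !=set0 & N `<=` O].
Proof.
move=> ab oO O0; have [M [cM M0 MT]] := proper_fat_subcontinuum ab.
have [_ clM _] := cM.
have nM0 : ~` M !=set0.
  by apply: contrapT => /nonemptyPn CE; apply: MT; rewrite -(setCK M) CE setC0.
have [|N [cN N0 NM]] := local_fat_subcontinuum cM M0 (closed_openC clM) nM0.
  by rewrite setIC setICr.
have [OM|OM] := pselect (O `<=` M).
  apply: (local_fat_subcontinuum cN N0 oO O0).
  by apply/seteqP; split=> // x [/OM Mx /NM].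
have [|||L [cL L0 LO]] := @local_fat_subcontinuum M (O `\` M) cM M0.
- by apply: openI => //; exact: closed_openC.
- by apply: contrapT => /nonemptyPn OME; apply: OM => x Ox; apply: contrapT => nMx;
    have : (O `\` M) x by []; rewrite OME.
- by apply/seteqP; split=> // x [[]].
- by exists L; split=> // x /LO[].
Qed.

(** * Separating points by subcontinua *)

Lemma splits_connected_sub (S1 S2 U V A : set X) :
  splits S1 S2 U V -> connected A -> A !=set0 -> A `&` (S1 `|` S2) = set0 ->
  A `<=` U \/ A `<=` V.
Proof.
move=> [oU oV UV SUV _] cA [x Ax] AS.
have AUV : A `<=` U `|` V.
  by move=> y Ay; rewrite -SUV => Sy; exact: setI0_False AS Ay Sy.
have [Ux|Vx] := AUV _ Ax.
  left; apply: (connected_open_cover cA oU oV) => //; last by exists x.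
  by rewrite -setIA UV setI0.
right; apply: (connected_open_cover cA oV oU) => //.
- by rewrite setUC.
- by rewrite -setIA (setIC V) UV setI0.
- by exists x.
Qed.

Lemma splits_notin1 (S1 S2 U V : set X) x : splits S1 S2 U V -> S1 x -> ~ U x.
Proof.
move=> [_ _ _ SUV _] Sx Ux; have : (~` (S1 `|` S2)) x by rewrite SUV; left.
by apply; left.
Qed.

Lemma splits_notin2 (S1 S2 U V : set X) x : splits S1 S2 U V -> S2 x -> ~ U x.
Proof.
move=> [_ _ _ SUV _] Sx Ux; have : (~` (S1 `|` S2)) x by rewrite SUV; left.
by apply; right.
Qed.

Lemma splits_sym (S1 S2 U V : set X) : splits S1 S2 U V -> splits S2 S1 U V.
Proof. by move=> [? ? ? ? ?]; split=> //; rewrite setUC. Qed.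

(** Let [V] and [V'] be the two pieces between [D] and [H], and choose fat
    subcontinua [M] in [V] and [M'] in [V'].  As on a circle, [D] and [H]
    lie in different pieces of the complement of [M `|` M'], and the
    complement of the piece around [H] is the required enlargement of [D].  They
    cannot lie in the same piece, because the other one would be contained in
    [V] or in [V'], while its closure meets both [M] and [M']. *)
Lemma subcontinuum_interpolation (D H : set X) :
  subcontinuum D -> subcontinuum H -> D `&` H = set0 -> D° !=set0 -> H° !=set0 ->
  exists D', [/\ subcontinuum D', D `<=` D'° & D' `&` H = set0].
Proof.
move=> cD cH DH D0 H0.
have [d Dd] : D !=set0 by have [] := cD.
have [h Hh] : H !=set0 by have [] := cH.
have dh : d <> h by move=> dh; apply: (setI0_False DH Dd); rewrite dh.
have [V [V' sV]] := splits_ex cD cH DH D0 H0.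
have [oV oV' VV' SV [V0 V'0]] := sV.
have [M [cM M0 MV]] := open_fat_subcontinuum dh oV V0.
have [M' [cM' M'0 MV']] := open_fat_subcontinuum dh oV' V'0.
have MM' : M `&` M' = set0.
  by apply/seteqP; split=> // x [/MV Vx /MV']; exact: setI0_False VV' Vx.
have [W [W' sW]] := splits_ex cM cM' MM' M0 M'0.
have out A : A `<=` D `|` H -> A `&` (M `|` M') = set0.
  move=> ADH; apply/seteqP; split=> // x [/ADH Ax Mx].
  have : (~` (D `|` H)) x; last by [].
  by rewrite SV; case: Mx => [/MV|/MV']; [left|right].
have DWW := splits_connected_sub sW (let: And3 _ _ c := cD in c)
  (ex_intro _ d Dd) (out D (@subsetUl _ _ _)).
have HWW := splits_connected_sub sW (let: And3 _ _ c := cH in c)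
  (ex_intro _ h Hh) (out H (@subsetUr _ _ _)).
have same A B : splits M M' A B -> D `<=` A -> H `<=` A -> False.
  move=> sA DA HA.
  have [_ _ AB _ [A0 B0]] := sA.
  have cB := splits_connected cM cM' MM' (splitsC sA).
  have BDH : B `&` (D `|` H) = set0.
    apply/seteqP; split=> // x [Bx [/DA Ax|/HA Ax]]; exact: setI0_False AB Ax Bx.
  have M'M : M' `&` M = set0 by rewrite setIC.
  have [BV|BV'] := splits_connected_sub sV cB B0 BDH.
    have [x [Bx M'x]] :=
      splits_closure cM' cM M'M (splits_sym (splitsC sA)).
    apply: (setI0_False _ Bx (MV' _ M'x)).
    apply: closure_open_disjoint => //; apply/seteqP; split=> // y [/BV Vy].
    exact: setI0_False VV' Vy.
  have [x [Bx Mx]] := splits_closure cM cM' MM' (splitsC sA).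
  apply: (setI0_False _ Bx (MV _ Mx)).
  apply: closure_open_disjoint => //; apply/seteqP; split=> // y [/BV' Vy Vy'].
  exact: setI0_False VV' Vy' Vy.
have main A B : splits M M' A B -> D `<=` A -> H `<=` B ->
    exists D', [/\ subcontinuum D', D `<=` D'° & D' `&` H = set0].
  move=> sA DA HB; have [oA oB AB _ _] := sA.
  exists (~` B); split.
  - exact: (splits_subcontinuumC cM cM' MM' (splitsC sA)).
  - move=> x /DA Ax; apply: (filterS _ (open_nbhs_nbhs (conj oA Ax))) => y Ay By.
    exact: setI0_False AB Ay By.
  - by apply/seteqP; split=> // x [nBx /HB].
case: DWW HWW => [DW|DW'] [HW|HW'].
- by have := same W W' sW DW HW.
- exact: (main W W').
- by apply: (main W' W) => //; exact: splitsC.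
- by have := same W' W (splitsC sW) DW' HW'.
Qed.

Definition nbhd_separated (x y : X) := exists D H : set X,
  [/\ subcontinuum D, subcontinuum H, D `&` H = set0, D° y & H° x].

Lemma nbhd_separatedW (x : X) (D H : set X) : subcontinuum D -> subcontinuum H ->
  D `&` H = set0 -> D° !=set0 -> H° x -> forall y, D y -> nbhd_separated x y.
Proof.
move=> cD cH DH D0 Hx y Dy.
have [D' [cD' DD' D'H]] := subcontinuum_interpolation cD cH DH D0 (ex_intro _ x Hx).
by exists D', H; split=> //; exact: DD'.
Qed.

(** When the subcontinua [D1], [D2] witnessing the two separations are
    disjoint, enlarge them to [E1], [E2] and take the closure of the piece of
    the complement of [E1 `|` E2] containing [x]: it is a subcontinuum around
    [x] which stays away from [D1] and [D2], hence lies in one of the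
    pieces between them.  The complement of that piece joins [y1] to [y2]. *)
Lemma nbhd_separated_join (x y1 y2 : X) : nbhd_separated x y1 -> nbhd_separated x y2 ->
  exists C, [/\ subcontinuum C, C y1, C y2 & forall y, C y -> nbhd_separated x y].
Proof.
move=> [D1 [F1 [cD1 cF1 DF1 Dy1 Fx1]]] [D2 [F2 [cD2 cF2 DF2 Dy2 Fx2]]].
have i1 : D1° !=set0 by exists y1.
have i2 : D2° !=set0 by exists y2.
have [E1 [cE1 DE1 EF1]] := subcontinuum_interpolation cD1 cF1 DF1 i1 (ex_intro _ x Fx1).
have [E2 [cE2 DE2 EF2]] := subcontinuum_interpolation cD2 cF2 DF2 i2 (ex_intro _ x Fx2).
have Ey1 : E1 y1 by apply: interior_subset; apply: DE1; exact: interior_subset.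
have Ey2 : E2 y2 by apply: interior_subset; apply: DE2; exact: interior_subset.
have e1 : E1° !=set0 by exists y1; apply: DE1; exact: interior_subset.
have e2 : E2° !=set0 by exists y2; apply: DE2; exact: interior_subset.
have sep1 := nbhd_separatedW cE1 cF1 EF1 e1 Fx1.
have sep2 := nbhd_separatedW cE2 cF2 EF2 e2 Fx2.
have [E12|/nonemptyPn E12] := pselect (E1 `&` E2 !=set0).
  exists (E1 `|` E2); split; [exact: subcontinuumU|by left|by right|].
  by move=> y [/sep1|/sep2].
have D12 : D1 `&` D2 = set0.
  apply/seteqP; split=> // y [/DE1/(@interior_subset _ _ _) E1y].
  move=> /DE2/(@interior_subset _ _ _); exact: setI0_False E12 E1y.
have [U [V sUV]] := splits_ex cE1 cE2 E12 e1 e2.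
have [W [W' sW]] := splits_ex cD1 cD2 D12 i1 i2.
suff main A B : splits E1 E2 A B -> A x ->
    exists C, [/\ subcontinuum C, C y1, C y2 & forall y, C y -> nbhd_separated x y].
  have : (~` (E1 `|` E2)) x.
    move=> [Ex|Ex]; first exact: setI0_False EF1 Ex (interior_subset Fx1).
    exact: setI0_False EF2 Ex (interior_subset Fx2).
  have [_ _ _ -> _] := sUV.
  by move=> [Ux|Vx]; [exact: (main U V)|apply: (main V U) => //; exact: splitsC].
move=> sA Ax; have [oA _ _ _ [A0 _]] := sA.
have cA := splits_connected cE1 cE2 E12 sA.
have clAD : closure A `&` (D1 `|` D2) = set0.
  have clAE : closure A `&` (E1° `|` E2°) = set0.
    apply: closure_open_disjoint; first by apply: openU; exact: open_interior.
    apply/seteqP; split=> // y.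
    move=> [Ay [/(@interior_subset _ _ _) Ey|/(@interior_subset _ _ _) Ey]].
      exact: (splits_notin1 sA Ey).
    exact: (splits_notin2 sA Ey).
  apply/seteqP; split=> // y [Ay Dy]; apply: (setI0_False clAE Ay).
  by case: Dy => [/DE1|/DE2]; [left|right].
have cclA := subcontinuum_closure A0 cA.
have Axi : (closure A)° x.
  by apply: (filterS _ (open_nbhs_nbhs (conj oA Ax))); exact: subset_closure.
suff inside P P' : splits D1 D2 P P' -> closure A `<=` P ->
    exists C, [/\ subcontinuum C, C y1, C y2 & forall y, C y -> nbhd_separated x y].
  have [cl0 _ ccl] := cclA.
  have [AB|AB] := splits_connected_sub sW ccl cl0 clAD.
    exact: (inside W W').
  exact: (inside W' W (splitsC sW)).
move=> sB AP.
have nB1 : ~ P y1 by apply: splits_notin1 sB _; exact: interior_subset.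
have nB2 : ~ P y2 by apply: splits_notin2 sB _; exact: interior_subset.
exists (~` P); split=> //; first exact: (splits_subcontinuumC cD1 cD2 D12 sB).
apply: (nbhd_separatedW _ cclA) => //.
- exact: (splits_subcontinuumC cD1 cD2 D12 sB).
- by apply/seteqP; split=> // y [nPy /AP].
- exists y1; apply: (filterS _ (open_nbhs_nbhs (conj (@open_interior _ D1) Dy1))).
  by move=> y /(@interior_subset _ _ _) Dy; exact: splits_notin1 sB Dy.
Qed.

(** The set [S] of points not separated from [x] is closed and, since every
    open set contains fat subcontinua, nowhere dense; its complement is
    connected by subcontinua ([nbhd_separated_join]).  So [S] blocks
    nothing and is reduced to [x]. *)
Lemma neq_separated (x y : X) : x <> y -> nbhd_separated x y.
Proof.
move=> xy; pose S := [set y | ~ nbhd_separated x y].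
have Sx : S x.
  move=> [D [H [_ _ DH /(@interior_subset _ _ _) Dx /(@interior_subset _ _ _)]]].
  exact: setI0_False DH Dx.
have clS : closed S.
  rewrite -openC openE => z /contrapT[D [H [cD cH DH Dz Hx]]].
  apply: (filterS _ (open_nbhs_nbhs (conj (@open_interior _ D) Dz))) => w Dw.
  by apply; exists D, H.
have thin O : open O -> O !=set0 -> exists2 z, O z & nbhd_separated x z.
  move=> oO O0; have [w Ow wx] := open_avoid x oO O0.
  have [||N [cN N0 NO]] := @open_fat_subcontinuum x y (O `&` ~` [set x]) xy.
  - by apply: openI => //; exact: closed_openC.
  - by exists w.
  have [D [cD D0 DN]] := open_fat_subcontinuum xy (@open_interior _ N) N0.
  have [z Dz] := D0.
  exists z.
    by have [] := NO _ (interior_subset (DN _ (interior_subset Dz))).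
  have nNx : ~ N x by move=> /NO[_]; apply.
  have [_ clN _] := cN.
  exists D, (closure (~` N)); split=> //.
  - by apply: subcontinuum_closure; [exists x|exact: complement_connected].
  - rewrite setIC; apply/seteqP; split=> // w' [clw /DN]; apply: setI0_False clw.
    apply: closure_open_disjoint; first exact: open_interior.
    by apply/seteqP; split=> // v [nNv /(@interior_subset _ _ _)].
  - apply: (filterS _ (open_nbhs_nbhs (conj (closed_openC clN) nNx))).
    exact: subset_closure.
apply: contrapT => Sy.
have [s SE] : exists s, S = [set s].
  apply: nb_only_point => //; first by exists x.
    have [z _ xz] := thin setT openT (ex_intro _ x I).
    by exists z => /(_ xz).
  move=> z O /contrapT xz oO O0; have [w Ow xw] := thin O oO O0.
  have [C [cC Cz Cw CS]] := nbhd_separated_join xz xw.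
  exists C; split=> //; last by exists w.
  by move=> v /CS xv nxv; exact: nxv.
apply: xy; have -> : x = s by have : [set s] x by rewrite -SE.
by have : [set s] y by rewrite -SE.
Qed.

(** * Every pair of points splits the space into two arcs *)

(** Around [a] and [b] there are subcontinua missing [z].  The piece of their
    complement containing [z] is connected, so its closure is as required. *)
Lemma subcontinuum_nbhs (a b z : X) : z <> a -> z <> b ->
  exists K, [/\ subcontinuum K, K° z, ~ K a & ~ K b].
Proof.
move=> za zb.
have [D [F [cD cF DF Da Fz]]] := neq_separated za.
have [E [G [cE cG EG Eb Gz]]] := neq_separated zb.
have nDz : ~ D z by move=> Dz; exact: setI0_False DF Dz (interior_subset Fz).
have nEz : ~ E z by move=> Ez; exact: setI0_False EG Ez (interior_subset Gz).
suff main O : open O -> O z -> connected O -> O `&` (D `|` E) = set0 ->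
    exists K, [/\ subcontinuum K, K° z, ~ K a & ~ K b].
  have [DE|/nonemptyPn DE] := pselect (D `&` E !=set0).
    have cDE := subcontinuumU cD cE DE; have [_ clDE _] := cDE.
    apply: (main (~` (D `|` E))).
    - exact: closed_openC.
    - by case.
    - exact: complement_connected.
    - by rewrite setICl.
  have [U [V sUV]] := splits_ex cD cE DE (ex_intro _ a Da) (ex_intro _ b Eb).
  have out U' V' : splits D E U' V' -> U' `&` (D `|` E) = set0.
    move=> s; apply/seteqP; split=> // x [Ux [Dx|Ex]].
      exact: splits_notin1 s Dx Ux.
    exact: splits_notin2 s Ex Ux.
  have [oU oV _ SUV _] := sUV.
  have : (~` (D `|` E)) z by case.
  rewrite SUV => -[Uz|Vz].
    apply: (main U) => //; last exact: out sUV.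
    exact: splits_connected cD cE DE sUV.
  apply: (main V) => //; last exact: out (splitsC sUV).
  exact: splits_connected cD cE DE (splitsC sUV).
move=> oO Oz cO ODE.
have clO : closure O `&` (D° `|` E°) = set0.
  apply: closure_open_disjoint; first by apply: openU; exact: open_interior.
  apply/seteqP; split=> // y [Oy [|] /(@interior_subset _ _ _) Ey];
    apply: (setI0_False ODE Oy); by [left|right].
exists (closure O); split.
- by apply: subcontinuum_closure => //; exists z.
- by apply: (filterS _ (open_nbhs_nbhs (conj oO Oz))); exact: subset_closure.
- by move=> clOa; apply: (setI0_False clO clOa); left.
- by move=> clOb; apply: (setI0_False clO clOb); right.
Qed.

(** If the complement of [{a, b}] were connected, small subcontinua would chain
    any two of its points together off [a] and [b], so that the pair would not
    block. *)
Lemma pair_splits (a b : X) : a <> b -> exists U V, splits [set a] [set b] U V.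
Proof.
move=> ab; have clab : closed [set a; b] by exact: closedU.
suff /(open_disconnected (closed_openC clab))[U [V [oU oV UV0 UV E]]] :
  ~ connected (~` [set a; b]) by exists U, V.
move=> cab.
have [z0 [_ za zb]] := @open_avoid2 setT a b openT (ex_intro _ a I).
pose U := [set z | exists K, [/\ subcontinuum K, K z0, K z, ~ K a & ~ K b]].
pose V := [set z | ~ U z] `&` ~` [set a; b].
have grow z : z <> a -> z <> b -> exists N, [/\ open N, N z,
    forall w w', N w -> N w' -> U w -> U w' & N `<=` ~` [set a; b]].
  move=> za' zb'; have [K [cK Kz nKa nKb]] := subcontinuum_nbhs za' zb'.
  exists K°; split=> //; first exact: open_interior.
    move=> w w' /(@interior_subset _ _ _) Kw /(@interior_subset _ _ _) Kw'.
    move=> [C [cC Cz0 Cw nCa nCb]]; exists (C `|` K); split.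
    - by apply: subcontinuumU => //; exists w.
    - by left.
    - by right.
    - by case.
    - by case.
  by move=> w /(@interior_subset _ _ _) Kw [|] /= wE; rewrite wE in Kw.
have Uab w : U w -> w <> a /\ w <> b.
  by move=> [K [_ _ Kw nKa nKb]]; split=> wE; rewrite wE in Kw.
have CU : ~` [set a; b] `<=` U.
  apply: (@connected_open_cover _ _ _ V) => //.
  - rewrite openE => w Uw; have [wa wb] := Uab _ Uw.
    have [N [oN Nw NU _]] := grow w wa wb.
    apply: (filterS _ (open_nbhs_nbhs (conj oN Nw))) => w' Nw'.
    exact: NU Uw.
  - rewrite openE => w [nUw nabw].
    have wa : w <> a by move=> wE; apply: nabw; left.
    have wb : w <> b by move=> wE; apply: nabw; right.
    have [N [oN Nw NU Nab]] := grow w wa wb.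
    apply: (filterS _ (open_nbhs_nbhs (conj oN Nw))) => w' Nw'.
    split; last exact: Nab.
    by move=> Uw'; apply: nUw; apply: NU Uw'.
  - by move=> w nab; have [Uw|nUw] := pselect (U w); [left|right; split].
  - by apply/seteqP; split=> // w [[_ Uw] [nUw _]].
  - exists z0; split; first by case.
    exists [set z0]; split=> //; [exact: subcontinuum1|by move=> /esym|by move=> /esym].
apply: (no_nonblocking_pair ab); first by exists z0.
move=> x O xa xb oO O0.
have [y [Oy ya yb]] := open_avoid2 a b oO O0.
have [|K [cK Kz0 Kx nKa nKb]] := CU x; first by case.
have [|K' [cK' Kz0' Ky nKa' nKb']] := CU y; first by case.
exists (K `|` K'); split; [|by left|by case|by case|by exists y; split=> //; right].
by apply: subcontinuumU => //; exists z0.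
Qed.

Lemma set1_disjoint (a b : X) : a <> b -> [set a] `&` [set b] = set0.
Proof. by move=> ab; apply/seteqP; split=> // x [/= -> ]. Qed.

Lemma splits_closure1 (a b : X) U V : a <> b -> splits [set a] [set b] U V ->
  closure U = U `|` [set a; b].
Proof.
move=> ab sUV; have [oU oV UV SUV _] := sUV.
have ca := subcontinuum1 a hX; have cb := subcontinuum1 b hX.
apply/seteqP; split=> x.
  move=> clUx; have [abx|nab] := pselect ([set a; b] x); first by right.
  left; have : (~` [set a; b]) x by [].
  rewrite SUV => -[//|Vx]; have := setI0_False (closure_open_disjoint oV UV) clUx Vx.
  by [].
move=> [Ux|[->|->]]; first exact: subset_closure.
  by have [y [clUy <-]] := splits_closure ca cb (set1_disjoint ab) sUV.
have dba := set1_disjoint (nesym ab).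
have [y [clUy <- //]] := splits_closure cb ca dba (splits_sym sUV).
Qed.

(** Every other point of [I] cuts [a] from [b]; in compact metric spaces this
    characterizes the arcs from [a] to [b] ([arc_parametrization]). *)
Definition arclike (I : set X) (a b : X) :=
  [/\ closed I, connected I, a <> b, I a /\ I b &
      forall z, I z -> z <> a -> z <> b -> exists L M, [/\ closed L, closed M,
        L a /\ M b, L `|` M = I & L `&` M = [set z]]].

(** For [z] in [U], let [A] be the piece cut off by [{a, z}] away from [b]
    and [B] the piece cut off by [{z, b}] away from [a].  Both avoid the
    connected set [V], and they are disjoint.  Together with [z] they
    exhaust [U]: otherwise the closures of [A] and [B] would form a
    subcontinuum separating [V] from the rest of [U]. *)
Lemma splits_arclike (a b : X) U V : a <> b -> splits [set a] [set b] U V ->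
  arclike (~` V) a b.
Proof.
move=> ab sUV; have [oU oV UV SUV [U0 V0]] := sUV.
have ca := subcontinuum1 a hX; have cb := subcontinuum1 b hX.
have dab := set1_disjoint ab.
have cV := splits_connected ca cb dab (splitsC sUV).
have [_ clI cI] := splits_subcontinuumC ca cb dab (splitsC sUV).
have clVE := splits_closure1 ab (splitsC sUV).
have nVa : ~ V a by exact: splits_notin1 (splitsC sUV) erefl.
have nVb : ~ V b by exact: splits_notin2 (splitsC sUV) erefl.
split=> // z nVz za zb.
have cz := subcontinuum1 z hX.
have Uz : U z.
  have : (~` [set a; b]) z by case.
  by rewrite SUV; case.
have choose p q r : p <> q -> r <> p -> r <> q ->
    exists A A', splits [set p] [set q] A A' /\ A' r.
  move=> pq rp rq; have [A [A' s]] := pair_splits pq.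
  have [_ _ _ sE _] := s; have : (~` [set p; q]) r by case.
  rewrite sE => -[Ar|A'r]; last by exists A, A'.
  by exists A', A; split=> //; exact: splitsC.
have [A [A' [sA A'b]]] := choose a z b (nesym za) (nesym ab) (nesym zb).
have [B [B' [sB B'a]]] := choose z b a zb (nesym za) ab.
have clA := splits_closure1 (nesym za) sA.
have clB := splits_closure1 zb sB.
have dVaz : V `&` [set a; z] = set0.
  by apply/seteqP; split=> // x [Vx [|] /= xE]; rewrite xE in Vx.
have dVzb : V `&` [set z; b] = set0.
  by apply/seteqP; split=> // x [Vx [|] /= xE]; rewrite xE in Vx.
have clVa : closure V a by rewrite clVE; right; left.
have clVb : closure V b by rewrite clVE; right; right.
have [oA oA' AA' SA [A0 A'0]] := sA.
have [oB oB' BB' SB [B0 B'0]] := sB.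
have VA' : V `<=` A'.
  have [VA|//] := splits_connected_sub sA cV V0 dVaz.
  have [y [Vy A'y]] := clVb _ (open_nbhs_nbhs (conj oA' A'b)).
  by have := setI0_False AA' (VA _ Vy) A'y.
have VB' : V `<=` B'.
  have [VB|//] := splits_connected_sub sB cV V0 dVzb.
  have [y [Vy B'y]] := clVa _ (open_nbhs_nbhs (conj oB' B'a)).
  by have := setI0_False BB' (VB _ Vy) B'y.
have nAa : ~ A a by exact: splits_notin1 sA erefl.
have nAz : ~ A z by exact: splits_notin2 sA erefl.
have nAb : ~ A b by move=> Ab; exact: setI0_False AA' Ab A'b.
have nBa : ~ B a by move=> Ba; exact: setI0_False BB' Ba B'a.
have nBz : ~ B z by exact: splits_notin1 sB erefl.
have nBb : ~ B b by exact: splits_notin2 sB erefl.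
have daz := set1_disjoint (nesym za); have dzb := set1_disjoint zb.
have cA := splits_connected ca cz daz sA.
have cB := splits_connected cz cb dzb sB.
have AB : A `&` B = set0.
  have dA : A `&` [set z; b] = set0.
    by apply/seteqP; split=> // x [Ax [|] /= xE]; rewrite xE in Ax.
  have [AsB|AsB'] := splits_connected_sub sB cA A0 dA.
    have clAa : closure A a by rewrite clA; right; left.
    have [y [Ay B'y]] := clAa _ (open_nbhs_nbhs (conj oB' B'a)).
    by have := setI0_False BB' (AsB _ Ay) B'y.
  by apply/seteqP; split=> // x [/AsB' B'x Bx]; exact: setI0_False BB' Bx B'x.
have cS : subcontinuum (closure A `|` closure B).
  apply: subcontinuumU; [exact: subcontinuum_closure|exact: subcontinuum_closure|].
  by exists z; rewrite clA clB; split; [right; right|right; left].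
exists (closure A), (closure B); split.
- exact: closed_closure.
- exact: closed_closure.
- by rewrite clA clB; split; right; [left|right].
- apply/seteqP; split=> x.
    rewrite clA clB => -[[Ax|[->|->]]|[Bx|[->|->]]] //= Vx.
      exact: setI0_False AA' Ax (VA' _ Vx).
    exact: setI0_False BB' Bx (VB' _ Vx).
  move=> nVx; apply: contrapT => nSx.
  pose T := U `&` (A' `&` B').
  have VSC y : ~ (closure A `|` closure B) y -> ~ V y -> T y.
    rewrite clA clB => nSy nVy.
    have ya : y <> a by move=> yE; apply: nSy; left; right; left.
    have yz : y <> z by move=> yE; apply: nSy; left; right; right.
    have yb : y <> b by move=> yE; apply: nSy; right; right; right.
    split.
      have : (~` [set a; b]) y by case.
      by rewrite SUV => -[].
    split.
      have : (~` [set a; z]) y by case.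
      by rewrite SA => -[Ay|//]; case: nSy; left; left.
    have : (~` [set z; b]) y by case.
    by rewrite SB => -[Ay|//]; case: nSy; right; left.
  have TV : ~` (closure A `|` closure B) `<=` V.
    apply: (connected_open_cover (complement_connected cS) oV (_ : open T)).
    - by apply: openI => //; exact: openI.
    - by move=> y /VSC nSy; have [Vy|/nSy] := pselect (V y); [left|right].
    - apply/seteqP; split=> // y [[_ Vy] [Uy _]]; exact: setI0_False UV Uy Vy.
    - have [v Vv] := V0; exists v; split=> //.
      rewrite clA clB => -[[Av|[/= vE|/= vE]]|[Bv|[/= vE|/= vE]]];
        try by rewrite vE in Vv.
        exact: setI0_False AA' Av (VA' _ Vv).
      exact: setI0_False BB' Bv (VB' _ Vv).
  exact: nVx (TV _ nSx).
- apply/seteqP; split=> x.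
    rewrite clA clB => -[[Ax|[xE|//]] [Bx|[//|xE']]].
    + by have := setI0_False AB Ax Bx.
    + by rewrite /= in xE'; rewrite xE' in Ax.
    + by rewrite /= in xE; rewrite xE in Bx.
    + by case: ab; rewrite -xE -xE'.
  by move=> ->; rewrite clA clB; split; right; [right|left].
Qed.
End PointNonblockers.

(** * Cut orders of arcs *)

(** A clopen part of [M] not containing [z] would be clopen in [E]. *)
Lemma cut_half_connected (T : topologicalType) (E L M : set T) z :
  connected E -> closed L -> closed M -> L `|` M = E -> L `&` M = [set z] ->
  connected M.
Proof.
move=> cE clL clM LME LMz; apply: contrapT => /(closed_disconnected clM).
have [Lz Mz] : (L `&` M) z by rewrite LMz.
suff main F G : closed F -> closed G -> G !=set0 -> F `&` G = set0 ->
    M = F `|` G -> ~ F z.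
  move=> [F [G [cF cG [F0 G0] FG MFG]]]; move: Mz; rewrite MFG => -[].
    exact: (main F G).
  by apply: (main G F); rewrite // 1?setIC 1?setUC.
move=> clF clG [g Gg] FG MFG Fz.
have LG : (L `|` F) `&` G = set0.
  apply/seteqP; split=> // x [[Lx|Fx] Gx]; last exact: setI0_False FG Fx Gx.
  have : (L `&` M) x by split=> //; rewrite MFG; right.
  by rewrite LMz => /= xz; rewrite xz in Gx; exact: setI0_False FG Fz Gx.
have GE : E `<=` G.
  apply: (@connected_closed_cover _ _ G (L `|` F)) => //.
  - exact: closedU.
  - by rewrite -LME MFG => x [Lx|[Fx|Gx]]; [right; left|right; right|left].
  - by rewrite -setIA (setIC G) LG setI0.
  - by exists g; split=> //; rewrite -LME MFG; right; right.
by apply: (setI0_False LG (or_introl Lz)); apply: GE; rewrite -LME; left.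
Qed.

(** The end points are included among the cut points, as degenerate cases, so
    that every point of [E] has its initial and its final part. *)
Definition cut_system (X : topologicalType) (E : set X) (a b : X)
    (L M : X -> set X) := forall z, E z ->
  [/\ closed (L z), closed (M z), L z a /\ M z b, L z `|` M z = E &
      L z `&` M z = [set z]] /\ (z = b -> L z = E).

Lemma arclike_cuts (R : realType) (X : metricType R) (E : set X) (a b : X) :
  arclike E a b -> exists L M, cut_system E a b L M.
Proof.
move=> [clE cE ab [Ea Eb] cut].
have cl1 (x : X) : closed [set x].
  exact/accessible_closed_set1/hausdorff_accessible/metric_hausdorff.
suff /choice[LM LMP] : forall z, exists LM : set X * set X, E z ->
    [/\ closed LM.1, closed LM.2, LM.1 a /\ LM.2 b, LM.1 `|` LM.2 = E &
        LM.1 `&` LM.2 = [set z]] /\ (z = b -> LM.1 = E).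
  by exists (fun z => (LM z).1), (fun z => (LM z).2) => z /LMP.
move=> z; have [->|za] := pselect (z = a).
  exists ([set a], E) => _; split; last by move=> /ab.
  split=> //=.
  - by apply/seteqP; split=> x; [move=> [->|]|right].
  - by apply/seteqP; split=> x; [move=> []|move=> ->; split].
have [->|zb] := pselect (z = b).
  exists (E, [set b]) => _; split; last by [].
  split=> //=.
  - by apply/seteqP; split=> x; [move=> [|->]|left].
  - by apply/seteqP; split=> x; [move=> []|move=> ->; split].
have [Ez|nEz] := pselect (E z); last by exists (E, E) => /nEz.
by have [L [M LMP]] := cut z Ez za zb; exists (L, M) => _; split.
Qed.

Section Arc.
Context (R : realType) (X : metricType R).
Hypothesis cX : compact [set: X].
Variables (E : set X) (a b : X) (L M : X -> set X).
Hypotheses (cE : connected E) (Ea : E a) (Eb : E b).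
Hypothesis LM : cut_system E a b L M.

Let clL z : E z -> closed (L z). Proof. by move=> /LM[[]]. Qed.
Let clM z : E z -> closed (M z). Proof. by move=> /LM[[]]. Qed.
Let La z : E z -> L z a. Proof. by move=> /LM[[? ? []]]. Qed.
Let Mb z : E z -> M z b. Proof. by move=> /LM[[? ? []]]. Qed.
Let LUM z : E z -> L z `|` M z = E. Proof. by move=> /LM[[]]. Qed.
Let LIM z : E z -> L z `&` M z = [set z]. Proof. by move=> /LM[[]]. Qed.
Let LbE : L b = E. Proof. by have [_ ->] := LM Eb. Qed.

Lemma cutL_sub z : E z -> L z `<=` E.
Proof. by move=> Ez x Lx; rewrite -(LUM Ez); left. Qed.

Lemma cut_self z : E z -> L z z /\ M z z.
Proof. by move=> Ez; have : [set z] z by []; rewrite -(LIM Ez) => -[]. Qed.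

Lemma cut_eq z x : E z -> L z x -> M z x -> x = z.
Proof. by move=> Ez Lx Mx; have : (L z `&` M z) x by []; rewrite (LIM Ez). Qed.

Lemma cut_connected z : E z -> connected (L z) /\ connected (M z).
Proof.
move=> Ez; split; last first.
  exact: (cut_half_connected cE (clL Ez) (clM Ez) (LUM Ez) (LIM Ez)).
apply: (cut_half_connected cE (clM Ez) (clL Ez) _ (_ : _ = [set z])).
  by rewrite setUC (LUM Ez).
by rewrite setIC (LIM Ez).
Qed.

Lemma cut_above z w : E z -> M z w -> w <> z -> L z `<=` L w.
Proof.
move=> Ez Mw wz; have Ew : E w by rewrite -(LUM Ez); right.
have [cLz _] := cut_connected Ez.
apply: (connected_closed_cover cLz (clL Ew) (clM Ew)).
- by rewrite (LUM Ew); exact: cutL_sub.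
- rewrite -setIA (LIM Ew); apply/seteqP; split=> // x [Lx xw].
  by rewrite xw in Lx; have := cut_eq Ez Lx Mw.
- by exists a; split; exact: La.
Qed.

(** The final part [M z] is connected and misses [w], so it lies on the side
    of [w] that contains [b]. *)
Lemma cut_below z w : E z -> L z w -> w <> z -> L w `<=` L z /\ ~ L w z.
Proof.
move=> Ez Lw wz; have Ew : E w by exact: cutL_sub Lw.
have [_ cMz] := cut_connected Ez.
have MzMw : M z `<=` M w.
  apply: (connected_closed_cover cMz (clM Ew) (clL Ew)).
  - by rewrite setUC (LUM Ew) -(LUM Ez); right.
  - rewrite -setIA (setIC (M w)) (LIM Ew); apply/seteqP; split=> // x [Mx xw].
    by rewrite xw in Mx; have := cut_eq Ez Lw Mx.
  - by exists b; split; exact: Mb.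
have nMw : ~ M z w by move=> Mw; have := cut_eq Ez Lw Mw.
have key x : L w x -> ~ M z x.
  by move=> Lx Mx; apply: nMw; rewrite -(cut_eq Ew Lx (MzMw _ Mx)).
split; last by move/key; apply; have [] := cut_self Ez.
move=> x Lx; have : E x by exact: cutL_sub Lx.
by rewrite -(LUM Ez) => -[//|/(key _ Lx)].
Qed.

(** If no point lies strictly between [p] and [q], then [L p] and [M q] are
    disjoint closed sets that cover [E]. *)
Lemma cut_dense p q : E q -> L q p -> p <> q ->
  exists r, [/\ E r, L q r, r <> q, L r p & r <> p].
Proof.
move=> Eq Lp pq; have Ep : E p by exact: cutL_sub Lp.
have [Lpq nLpq] := cut_below Eq Lp pq.
apply: contrapT => nor; apply: (nLpq).
suff : E `<=` L p by apply.
apply: (connected_closed_cover cE (clL Ep) (clM Eq)).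
- move=> r Er; apply: contrapT => nr; apply: nor; exists r.
  have nLr : ~ L p r by move=> Lr; apply: nr; left.
  have nMr : ~ M q r by move=> Mr; apply: nr; right.
  have rp : r <> p by move=> rp; apply: nLr; rewrite rp; have [] := cut_self Ep.
  split=> //.
  + by move: Er; rewrite -(LUM Eq) => -[|/nMr].
  + by move=> rq; apply: nMr; rewrite rq; have [] := cut_self Eq.
  + have Mr : M p r by move: Er; rewrite -(LUM Ep) => -[/nLr|].
    by apply: (cut_above Ep Mr rp); have [] := cut_self Ep.
- apply/seteqP; split=> // x [[Ex Lx] Mx]; apply: nLpq.
  by rewrite -(cut_eq Eq (Lpq _ Lx) Mx).
- by exists a; split=> //; exact: La.
Qed.

Local Open Scope ring_scope.

Definition least (h : X -> R) (c : X) : R := inf (h @` L c).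

Section Least.
Variable h : X -> R.
Hypotheses (hc : continuous h) (h0 : forall x, 0 <= h x).

Let lb c : has_lbound (h @` L c).
Proof. by exists 0 => _ [x _ <-]. Qed.

Lemma least_le c p : L c p -> least h c <= h p.
Proof. by move=> Lp; apply: ge_inf; [exact: lb|exists p]. Qed.

Lemma least_ge c e : E c -> (forall p, L c p -> e <= h p) -> e <= least h c.
Proof.
move=> Ec ep; apply: lb_le_inf; first by exists (h c), c => //; have [] := cut_self Ec.
by move=> _ [p Lp <-]; exact: ep.
Qed.

Lemma least_anti z w : E z -> E w -> L w `<=` L z -> least h z <= least h w.
Proof. by move=> Ez Ew Lwz; apply: least_ge => // p /Lwz; exact: least_le. Qed.

Lemma least_ge0 c : E c -> 0 <= least h c.
Proof. by move=> Ec; apply: least_ge. Qed.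

(** A nearly minimal point [p] of [L c] either is [c] itself, and continuity of
    [h] applies, or precedes [c], and then it belongs to [L c'] for all [c']
    near [c]. *)
Lemma least_upper c (e : R) : 0 < e -> E c ->
  \forall c' \near c, E c' -> least h c' < least h c + e.
Proof.
move=> e0 Ec.
have [|_ [p Lp <-] hp] := inf_adherent e0 (_ : has_inf (h @` L c)).
  by split; [exists (h c), c => //; have [] := cut_self Ec|exact: lb].
have Ep := cutL_sub Ec Lp.
have [pc|pc] := pselect (p = c).
  have /cvgrPdist_lt/(_ (least h c + e - h c)) := @hc c.
  rewrite subr_gt0 -{1}pc => /(_ hp); apply: filterS => c' hcc' Ec'.
  apply: (@le_lt_trans _ _ (h c')).
    by apply: least_le; have [] := cut_self Ec'.
  move: hcc'; rewrite ltr_norml => /andP[+ _]; lra.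
have [_ nLpc] := cut_below Ec Lp pc.
apply: (filterS _ (open_nbhs_nbhs (conj (closed_openC (clL Ep)) nLpc))).
move=> c' nLp Ec'; apply: le_lt_trans hp; apply: least_le.
have c'p : c' <> p by move=> c'p; apply: nLp; rewrite c'p; have [] := cut_self Ep.
have Mp : M p c' by move: Ec'; rewrite -(LUM Ep) => -[/nLp|].
by apply: (cut_above Ep Mp c'p); have [] := cut_self Ep.
Qed.

(** By compactness, since the initial parts beyond [c] decrease to [L c] as
    the order is dense. *)
Lemma cut_next c (K : set X) : E c -> c <> b -> closed K -> K `<=` E ->
  K `&` L c = set0 -> exists r, [/\ E r, L r c, r <> c & K `&` L r = set0].
Proof.
move=> Ec cb clK KE KLc; apply: contrapT => nor.
pose above r := [/\ E r, L r c & r <> c].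
have ab0 : above b by split=> //; [rewrite LbE|exact: nesym].
pose F := filter_from above (fun r => K `&` L r).
have FF : Filter F.
  apply: filter_from_filter; first by exists b.
  move=> r s [Er rc rnc] [Es sc snc].
  have [srL|] := pselect (L r s).
    exists s => // x [Kx Lx]; split=> //; split=> //.
    have [sr|sr] := pselect (s = r); first by rewrite -sr.
    by have [Lsr _] := cut_below Er srL sr; exact: Lsr.
  move=> nLr; exists r => // x [Kx Lx]; split=> //; split=> //.
  have sr : s <> r by move=> sr; apply: nLr; rewrite sr; have [] := cut_self Er.
  have Mr : M r s by move: Es; rewrite -{1}(LUM Er) => -[/nLr|].
  exact: (cut_above Er Mr sr).
have PF : ProperFilter F.
  apply: filter_from_proper => r [Er rc rnc].
  by apply: contrapT => /nonemptyPn KL; apply: nor; exists r.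
have [x [_ clx]] := cX PF filterT.
have inF r : above r -> (K `&` L r) x.
  move=> ra; have [Er _ _] := ra.
  have clKL : closed (K `&` L r) by apply: closedI => //; exact: clL.
  apply: clKL => N Nx; have [|y [? ?]] := clx (K `&` L r) N _ Nx; first by exists r.
  by exists y.
have [Kx _] := inF b ab0.
have nLx : ~ L c x by move=> Lx; exact: setI0_False KLc Kx Lx.
have Ex := KE _ Kx.
have xc : x <> c by move=> xc; apply: nLx; rewrite xc; have [] := cut_self Ec.
have Mx : M c x by move: Ex; rewrite -(LUM Ec) => -[/nLx|].
have Lxc : L x c by apply: (cut_above Ec Mx xc); have [] := cut_self Ec.
have [r [Er Lxr rx Lrc rc]] := cut_dense Ex Lxc (nesym xc).
have [_ nLrx] := cut_below Ex Lxr rx.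
by have [//|_ /nLrx] := inF r.
Qed.

(** The set [K] of points where [h] is too small misses [L c], hence also the
    initial part of some [r] beyond [c], which contains [L c'] for all [c']
    near [c]. *)
Lemma least_lower c (e : R) : closed E -> 0 < e -> E c ->
  \forall c' \near c, E c' -> least h c - e < least h c'.
Proof.
move=> clE e0 Ec; have [->|cb] := pselect (c = b).
  apply: filterE => c' Ec'; apply: (@lt_le_trans _ _ (least h b)).
    by rewrite ltrBlDr ltrDl.
  by apply: least_anti => //; rewrite LbE; exact: cutL_sub.
pose K := E `&` (h @^-1` [set y | y <= least h c - e / 2]).
have clK : closed K.
  apply: closedI => //; apply: closed_comp => //; exact: closed_le.
have [|r [Er Lrc rc KLr]] := cut_next Ec cb clK (@subIsetl _ _ _) _.
  apply/seteqP; split=> // x [[_ /= hx] /least_le]; lra.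
have nMc : ~ M r c by move=> Mc; apply: rc; rewrite (cut_eq Er Lrc Mc).
apply: (filterS _ (open_nbhs_nbhs (conj (closed_openC (clM Er)) nMc))) => c' nMc' Ec'.
have Lc' : L r c' by move: Ec'; rewrite -{1}(LUM Er) => -[|/nMc'].
apply: (@lt_le_trans _ _ (least h c - e / 2)); first lra.
apply: least_ge => // p Lp; rewrite leNgt; apply/negP => /ltW hp.
have Lrp : L r p.
  have [c'r|c'r] := pselect (c' = r); first by rewrite -c'r.
  by have [Lsub _] := cut_below Er Lc' c'r; exact: Lsub.
by apply: (setI0_False KLr _ Lrp); split=> //; exact: cutL_sub Lp.
Qed.

Lemma least_continuous : closed E -> {within E, continuous (least h)}.
Proof.
move=> clE; apply/subspace_continuousP => c Ec; apply/cvgrPdist_lt => e e0.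
rewrite near_withinE; have up := least_upper e0 Ec; have lo := least_lower clE e0 Ec.
apply: filterS2 up lo => c' up lo Ec'.
have := up Ec'; have := lo Ec'; rewrite ltr_norml; lra.
Qed.

End Least.

End Arc.

Local Open Scope ring_scope.

(** * Weighted sums of functions *)

Section WeightedSum.
Context (R : realType) (T : Type) (A : set T) (m : nat -> T -> R).
Hypothesis m01 : forall n x, A x -> 0 <= m n x <= 1.

Let w (n : nat) : R := 2^-1 ^+ n.
Let w0 n : 0 < w n. Proof. by rewrite exprn_gt0// invr_gt0. Qed.
Let wS n : w n = w n.+1 + w n.+1.
Proof. by rewrite /w exprS; move: (2^-1 ^+ n) => t; lra. Qed.

Let S N x : R := \sum_(i < N) w i.+1 * m i x.

Let SS N x : S N.+1 x = S N x + w N.+1 * m N x.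
Proof. by rewrite /S big_ord_recr. Qed.

Let S_tail N k x : A x -> S N x <= S (N + k) x <= S N x + w N - w (N + k).
Proof.
move=> Ax; elim: k => [|k /andP[IH1 IH2]]; first by rewrite addn0 addrK !lexx.
rewrite addnS SS; have /andP[m0 m1] := m01 (N + k)%N Ax.
have wm0 : 0 <= w (N + k).+1 * m (N + k) x by rewrite mulr_ge0// ltW.
have wm1 : w (N + k).+1 * m (N + k) x <= w (N + k).+1 by rewrite ler_piMr// ltW.
have := wS (N + k); move: wm0 wm1 IH1 IH2; lra.
Qed.

Let S_mono N N' x : A x -> (N <= N')%N -> S N x <= S N' x.
Proof. by move=> Ax /subnKC <-; have /andP[] := S_tail N (N' - N) Ax. Qed.

Let S_bound N N' x : A x -> S N' x <= S N x + w N.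
Proof.
move=> Ax; have [NN'|/ltnW N'N] := leqP N N'; last first.
  by apply: (le_trans (S_mono Ax N'N)); rewrite lerDl ltW.
rewrite -(subnKC NN'); have /andP[_] := S_tail N (N' - N) Ax.
have := w0 (N + (N' - N))%N; lra.
Qed.

(** The sum of the series with terms [2 ^- (n + 1) * m n x], written as a
    supremum because its terms are nonnegative. *)
Definition weighted_sum x : R := sup (range (S^~ x)).

Let f_ge N x : A x -> S N x <= weighted_sum x.
Proof.
move=> Ax; apply: sup_upper_bound; last by exists N.
split; first by exists (S 0%N x), 0%N.
by exists (S 0%N x + w 0%N) => _ [N' _ <-]; exact: S_bound.
Qed.

Let f_le N x : A x -> weighted_sum x <= S N x + w N.
Proof.
move=> Ax; apply: ge_sup; first by exists (S 0%N x), 0%N.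
by move=> _ [N' _ <-]; exact: S_bound.
Qed.

Lemma weighted_sum_lt x y n : A x -> A y -> (forall k, m k x <= m k y) ->
  m n x < m n y -> weighted_sum x < weighted_sum y.
Proof.
move=> Ax Ay mxy nxy; set d := w n.+1 * (m n y - m n x).
have d0 : 0 < d by rewrite mulr_gt0// subr_gt0.
have S_le N : S N x <= S N y by apply: ler_sum => i _; rewrite ler_wpM2l// ltW.
have S_lt k : S (n.+1 + k) x + d <= S (n.+1 + k) y.
  elim: k => [|k IH].
    rewrite addn0 !SS /d mulrBr; have := S_le n; lra.
  have := ler_wpM2l (ltW (w0 (n.+1 + k).+1)) (mxy (n.+1 + k)%N).
  by rewrite addnS (SS (n.+1 + k)%N x) (SS (n.+1 + k)%N y); move: IH; lra.
suff : weighted_sum x <= weighted_sum y - d by move: d0; lra.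
apply: ge_sup; first by exists (S 0%N x), 0%N.
move=> _ [N _ <-]; rewrite lerBrDr.
apply: le_trans (f_ge (n.+1 + N) Ay); apply: le_trans (S_lt N).
by rewrite lerD2r; apply: S_mono => //; exact: leq_addl.
Qed.

Lemma weighted_sum_cvg (F : set_system T) x : Filter F -> F A -> A x ->
  (forall n, m n @ F --> m n x) -> weighted_sum @ F --> weighted_sum x.
Proof.
move=> FF FA Ax mF.
have SF N : S N @ F --> S N x.
  elim: N => [|N IH].
    rewrite (_ : S 0%N = cst (S 0%N x)); first exact: cvg_cst.
    by apply/funext => y; rewrite /S !big_ord0.
  rewrite (_ : S N.+1 = (fun y => S N y + w N.+1 * m N y)); last first.
    by apply/funext => y; rewrite SS.
  apply: cvgD => //; apply: cvgM => //; exact: cvg_cst.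
apply/cvgrPdist_lt => e e0.
have e2 : 0 < e / 2 by rewrite divr_gt0.
have [N wN] : exists N, w N < e / 2.
  have [N _ /(_ N (leqnn N)) /= wN] := near_infty_natSinv_expn_lt (PosNum e2).
  by exists N; rewrite /w exprVn -div1r.
have /cvgrPdist_lt/(_ _ e2) := SF N; apply: filterS2 FA => y Ay.
have := f_ge N Ax; have := f_le N Ax; have := f_ge N Ay; have := f_le N Ay.
have := w0 N; rewrite !ltr_norml; lra.
Qed.
End WeightedSum.

(** * Arcs are parametrized by the unit interval *)

Definition truncated_dist (R : realType) (X : metricType R) (q x : X) : R :=
  Num.min 1 (mdist q x).

Lemma truncated_dist_continuous (R : realType) (X : metricType R) (q : X) :
  continuous (truncated_dist q).
Proof.
move=> x; apply/cvgrPdist_lt => e e0.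
have := nbhsx_ballx x e e0; apply: filterS => y; rewrite ballEmdist /= => xy.
have := metric_triangle q x y; have := metric_triangle q y x.
rewrite (metric_sym y x) /truncated_dist /Num.min ltr_norml => t1 t2.
by case: ifPn; case: ifPn; rewrite -?leNgt => *; apply/andP; split; lra.
Qed.

Lemma truncated_dist_itv (R : realType) (X : metricType R) (q x : X) :
  0 <= truncated_dist q x <= 1.
Proof.
have := mdist_ge0 q x; rewrite /truncated_dist /Num.min.
by case: ifPn; rewrite -?leNgt => *; apply/andP; split; lra.
Qed.

(** The distance from [q] to [L z] decreases weakly with [z]; it does so
    strictly between [y] and [x] if [q] is close to [x] and far from [L y],
    which holds for some point of the dense sequence. *)
Lemma arc_parametrization (R : realType) (X : metricType R) (E : set X) (a b : X) :
  compact [set: X] -> arclike E a b -> exists g : X -> R,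
    [/\ {within E, continuous g}, {in E &, injective g}, g a = 0, g b = 1 &
        forall x, E x -> 0 <= g x <= 1].
Proof.
move=> cX aE; have [clE cE ab [Ea Eb] _] := aE.
have [L [M LM]] := arclike_cuts aE.
have clL z : E z -> closed (L z) by move=> /LM[[]].
have La z : E z -> L z a by move=> /LM[[? ? []]].
have LUM z : E z -> L z `|` M z = E by move=> /LM[[]].
have LbE : L b = E by have [_ ->] := LM b Eb.
have [q qP] := dense_sequence cX a.
pose m n := least L (truncated_dist (q n)).
have h0 n x : 0 <= truncated_dist (q n) x by have /andP[] := truncated_dist_itv (q n) x.
have self z : E z -> L z z by move=> Ez; have [] := cut_self LM Ez.
have m01 n x : E x -> 0 <= m n x <= 1.
  move=> Ex; apply/andP; split; first exact: (least_ge0 LM).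
  have /andP[_] := truncated_dist_itv (q n) x; apply: le_trans.
  by apply: least_le => //; exact: self.
pose f := weighted_sum m.
have fc : {within E, continuous f}.
  apply/subspace_continuousP => c Ec.
  apply: (weighted_sum_cvg m01) => //.
    exact: withinT.
  move=> n; have /subspace_continuousP := least_continuous cX cE Ea Eb LM
    (@truncated_dist_continuous _ _ (q n)) (h0 n) clE.
  exact.
have f_anti x y : E x -> L x y -> y <> x -> f x < f y.
  move=> Ex Lxy yx; have Ey := cutL_sub LM Ex Lxy.
  have [Lyx nLyx] := cut_below cE LM Ex Lxy yx.
  have [k kL] := closed_ball_avoid (clL _ Ey) nLyx.
  set e : R := k.+1%:R^-1 in kL.
  have e0 : 0 < e by rewrite invr_gt0 ltr0n.
  have e1 : e <= 1 by rewrite invf_le1// ler1n.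
  have [||n xn] := qP (ball x (e / 2))°; first exact: open_interior.
    by exists x; apply: nbhsx_ballx; rewrite divr_gt0.
  have {}xn : mdist (q n) x < e / 2.
    by move: xn => /(@interior_subset _ _ _); rewrite ballEmdist /= metric_sym.
  apply: (weighted_sum_lt m01 (n := n)) => //.
    by move=> j; apply: (least_anti LM).
  apply: (@lt_le_trans _ _ (e / 2)).
    apply: (@le_lt_trans _ _ (truncated_dist (q n) x)).
      by apply: least_le => //; exact: self.
    by rewrite /truncated_dist /Num.min; case: ifPn; rewrite -?leNgt; lra.
  apply: (least_ge LM) => // p Lp.
  have : ~ ball x e p by move=> /kL.
  rewrite ballEmdist /= => /negP; rewrite -leNgt => xp.
  have := metric_triangle x (q n) p; rewrite (metric_sym x (q n)) => tri.
  by rewrite /truncated_dist /Num.min; case: ifPn; rewrite -?leNgt; lra.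
have total x y : E x -> E y -> y <> x -> L x y \/ L y x.
  move=> Ex Ey yx; move: (Ey); rewrite -(LUM _ Ex) => -[|Mxy]; first by left.
  right; apply: (cut_above cE LM Ex Mxy yx); exact: self.
have f_inj x y : E x -> E y -> f x = f y -> x = y.
  move=> Ex Ey fxy; apply: contrapT => xy.
  have [Lx|Ly] := total x y Ex Ey (nesym xy).
    by have := f_anti x y Ex Lx (nesym xy); rewrite fxy ltxx.
  by have := f_anti y x Ey Ly xy; rewrite fxy ltxx.
have fa x : E x -> f x <= f a.
  move=> Ex; have [->//|xa] := pselect (x = a).
  by apply/ltW/f_anti => //; [exact: La|exact: nesym].
have fb x : E x -> f b <= f x.
  move=> Ex; have [->//|xb] := pselect (x = b).
  by apply/ltW/f_anti => //; rewrite LbE.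
have fab : 0 < f a - f b.
  by rewrite subr_gt0; apply: f_anti => //; rewrite LbE.
exists (fun x => (f a - f x) / (f a - f b)); split.
- apply/subspace_continuousP => c Ec; have /subspace_continuousP/(_ c Ec) fcc := fc.
  by apply: cvgM; [apply: cvgB => //; exact: cvg_cst|exact: cvg_cst].
- move=> x y /set_mem Ex /set_mem Ey /=; have d0 : (f a - f b)^-1 != 0.
    by rewrite invr_neq0 // gt_eqF.
  by move/(mulIf d0) => fxy; apply: f_inj => //; lra.
- by rewrite subrr mul0r.
- by rewrite divff // gt_eqF.
- move=> x Ex; rewrite divr_ge0 ?subr_ge0 ?fa ?fb //=.
  by rewrite ler_pdivrMr // mul1r lerD2l lerN2 fb.
Qed.

(** * Gluing two arcs into a circle *)

(** For [s] equal to [1] or [-1] and [t] from [0] to [1], the upper or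
    lower half of the circle, run through from left to right. *)
Definition half_circle (R : realType) (s t : R) : R * R :=
  (t *+ 2 - 1, s * Num.sqrt (1 - (t *+ 2 - 1) ^+ 2)).

Lemma half_circle_continuous (R : realType) (s : R) : continuous (half_circle s).
Proof.
move=> t; have lin : (fun t : R => t *+ 2 - 1) x @[x --> t] --> t *+ 2 - 1.
  by apply: cvgB; [apply: cvgMn; exact: cvg_id|exact: cvg_cst].
have sq : (fun t : R => 1 - (t *+ 2 - 1) ^+ 2) x @[x --> t] --> 1 - (t *+ 2 - 1) ^+ 2.
  apply: cvgB; first exact: cvg_cst.
  by rewrite expr2; under eq_fun do rewrite expr2; apply: cvgM.
have snd : s * Num.sqrt (1 - (x *+ 2 - 1) ^+ 2) @[x --> t] -->
    s * Num.sqrt (1 - (t *+ 2 - 1) ^+ 2).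
  apply: cvgM; first exact: cvg_cst.
  exact: (@continuous_comp _ _ _ _ _ t sq (@sqrt_continuous R _)).
exact: cvg_pair lin snd.
Qed.

Lemma half_circle_within (R : realType) (T : topologicalType) (E : set T)
    (g : T -> R) (s : R) :
  {within E, continuous g} -> {within E, continuous (half_circle s \o g)}.
Proof.
move=> /subspace_continuousP gc; apply/subspace_continuousP => x Ex.
by have := cvg_comp _ _ (gc x Ex) (@half_circle_continuous _ s (g x)).
Qed.

Lemma half_circle_sqr (R : realType) (s t : R) : s ^+ 2 = 1 -> 0 <= t <= 1 ->
  (half_circle s t).1 ^+ 2 + (half_circle s t).2 ^+ 2 = 1.
Proof.
move=> s1 /andP[t0 t1] /=; rewrite exprMn s1 mul1r sqr_sqrtr.
  by rewrite addrC subrK.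
rewrite subr_ge0 expr2; nra.
Qed.

Lemma within_surjective (R : realType) (T : topologicalType) (E : set T)
    (g : T -> R) (a b : T) :
  connected E -> {within E, continuous g} -> E a -> E b -> g a = 0 -> g b = 1 ->
  forall t, 0 <= t <= 1 -> exists2 x, E x & g x = t.
Proof.
move=> cE gc Ea Eb ga gb t t01.
have /connected_intervalP itv := connected_continuous_connected cE gc.
have [|||x Ex gx] := itv 0 1 _ _ t; last by exists x.
- by exists a.
- by exists b.
- by [].
Qed.

(** Images of closed sets are compact, so the inverse is continuous. *)
Lemma circle_of_bijection (R : realType) (X : topologicalType) (phi : X -> R * R) :
  compact [set: X] -> continuous phi -> injective phi ->
  phi @` setT = unit_circle R -> simple_closed_curve R X.
Proof.
move=> cX pc pinj pim.
have pcirc x : phi x \in unit_circle R by rewrite -pim; apply/mem_set; exists x.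
pose f x : set_type (unit_circle R) := SigSub (pcirc x).
have fsurj (p : set_type (unit_circle R)) : exists x, phi x = val p.
  suff [x _ <-] : range phi (val p) by exists x.
  by rewrite pim; apply: set_mem; exact: (valP p).
have [g gP] := choice fsurj.
have fK : cancel f g by move=> x; apply: pinj; rewrite gP.
have gK : cancel g f by move=> p; apply: val_inj; rewrite /= gP.
exists f, g; split=> //.
  by apply: continuous_comp_initial.
apply/continuous_closedP => C clC.
have -> : g @^-1` C = (val : set_type (unit_circle R) -> R * R) @^-1` (phi @` C).
  apply/seteqP; split=> p /=; first by move=> Cg; exists (g p) => //; rewrite gP.
  by move=> [x Cx xp]; rewrite (_ : g p = x) //; apply: pinj; rewrite gP.
apply: closed_comp.
  by move=> p _; exact: initial_continuous.
apply: compact_closed; first exact: norm_hausdorff.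
apply: continuous_compact; first exact: continuous_subspaceT.
exact: (subclosed_compact clC cX).
Qed.

Lemma circle_of_arcs (R : realType) (X : metricType R) (E F : set X) (a b : X) :
  compact [set: X] -> arclike E a b -> arclike F a b -> E `|` F = setT ->
  E `&` F = [set a; b] -> simple_closed_curve R X.
Proof.
move=> cX aE aF EF EIF.
have [g [gc gi ga gb g01]] := arc_parametrization cX aE.
have [h [hc hi ha hb h01]] := arc_parametrization cX aF.
have [clE cE ab [Ea Eb] _] := aE; have [clF cF _ [Fa Fb] _] := aF.
pose phi x := if x \in E then half_circle 1 (g x) else half_circle (-1) (h x).
have phiE x : E x -> phi x = half_circle 1 (g x) by rewrite /phi => /mem_set ->.
have phiF x : F x -> phi x = half_circle (-1) (h x).
  move=> Fx; rewrite /phi; case: ifPn => // /set_mem Ex.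
  have [->|->] : [set a; b] x by rewrite -EIF.
    by rewrite ga ha /half_circle mul0rn sub0r sqrrN expr1n subrr sqrtr0 !mulr0.
  rewrite gb hb /half_circle (_ : 1 *+ 2 - 1 = 1 :> R); last lra.
  by rewrite expr1n subrr sqrtr0 !mulr0.
have cover x : E x \/ F x by have : (E `|` F) x by rewrite EF.
apply: (@circle_of_bijection _ _ phi) => //.
- apply/continuous_subspace_setT; rewrite -EF; apply: withinU_continuous => //.
    apply: (@subspace_eq_continuous _ _ _ (half_circle 1 \o g)).
      by move=> x /set_mem Ex; exact/esym/phiE.
    exact: half_circle_within.
  apply: (@subspace_eq_continuous _ _ _ (half_circle (-1) \o h)).
    by move=> x /set_mem Fx; exact/esym/phiF.
  exact: half_circle_within.
- have EFeq x y : E x -> F y -> phi x = phi y -> x = y.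
    move=> Ex Fy; rewrite phiE // phiF // => -[gh].
    have {}gh : g x = h y by lra.
    rewrite gh mul1r mulN1r => sq.
    have /andP[hy0 hy1] := h01 y Fy.
    have s0 : Num.sqrt (1 - (h y *+ 2 - 1) ^+ 2) = 0 by lra.
    have /eqP : h y * (1 - h y) = 0.
      move/eqP: s0; rewrite sqrtr_eq0 expr2; nra.
    rewrite mulf_eq0 => /orP[/eqP h0|/eqP h1].
      transitivity a; [apply: gi|apply: hi]; rewrite ?inE ?gh ?h0 ?ga ?ha //.
    have {}h1 : h y = 1 by lra.
    by transitivity b; [apply: gi|apply: hi]; rewrite ?inE ?gh ?h1 ?gb ?hb.
  move=> x y; have [Ex|Fx] := cover x; have [Ey|Fy] := cover y.
  + rewrite !phiE // => -[gxy _]; apply: gi; rewrite ?inE //; lra.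
  + exact: EFeq.
  + by move=> /esym/(EFeq _ _ Ey Fx).
  + rewrite !phiF // => -[gxy _]; apply: hi; rewrite ?inE //; lra.
- apply/seteqP; split.
    move=> _ [x _ <-]; have [Ex|Fx] := cover x.
      by rewrite phiE //; apply: half_circle_sqr (g01 _ Ex); rewrite expr1n.
    by rewrite phiF //; apply: half_circle_sqr (h01 _ Fx); rewrite sqrrN expr1n.
  move=> [u v] uv; have {}uv : u ^+ 2 + v ^+ 2 = 1 := uv.
  have u1 : `|u| <= 1.
    rewrite -(@ler_pXn2r _ 2) ?nnegrE // expr1n real_normK ?num_real //.
    by rewrite -uv lerDl sqr_ge0.
  have t01 : 0 <= (u + 1) / 2 <= 1.
    by move: u1; rewrite ler_norml => /andP[u0 u1]; apply/andP; split; lra.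
  have tu : ((u + 1) / 2) *+ 2 - 1 = u by lra.
  have vu : 1 - u ^+ 2 = v ^+ 2 by lra.
  have [v0|/ltW v0] := leP 0 v.
    have [x Ex gx] := within_surjective cE gc Ea Eb ga gb t01.
    exists x => //; rewrite phiE // gx /half_circle tu vu sqrtr_sqr.
    by rewrite ger0_norm // mul1r.
  have [x Fx hx] := within_surjective cF hc Fa Fb ha hb t01.
  exists x => //; rewrite phiF // hx /half_circle tu vu sqrtr_sqr.
  by rewrite ler0_norm // mulN1r opprK.
Qed.

(** * The circle minus a point *)

(** Inverse stereographic projection from [p], with [t] the coordinate on the
    diameter orthogonal to [p]. *)
Definition punctured_circle (R : realType) (p : R * R) (t : R) : R * R :=
  ((- p.1 * (1 - t ^+ 2) + - p.2 * (t *+ 2)) / (1 + t ^+ 2),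
   (- p.2 * (1 - t ^+ 2) + p.1 * (t *+ 2)) / (1 + t ^+ 2)).

(** An affine function of [q] vanishing at [p] and at the point of parameter
    [s]: it tells the two sides of the chord between them. *)
Definition chord_sign (R : realType) (p : R * R) (s : R) (q : R * R) : R :=
  (p.1 * q.2 - p.2 * q.1) - s * (1 - (p.1 * q.1 + p.2 * q.2)).

Section PuncturedCircle.
Context (R : realType) (p : R * R).
Hypothesis circp : unit_circle R p.

Let d0 (t : R) : 1 + t ^+ 2 != 0.
Proof. by apply/lt0r_neq0; rewrite ltr_wpDr ?sqr_ge0. Qed.

Let pE : p.2 ^+ 2 = 1 - p.1 ^+ 2.
Proof. by have : p.1 ^+ 2 + p.2 ^+ 2 = 1 := circp; move=> <-; ring. Qed.

Lemma punctured_circle_in t : unit_circle R (punctured_circle p t).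
Proof.
rewrite /unit_circle /=.
transitivity ((p.1 ^+ 2 + p.2 ^+ 2) * ((1 + t ^+ 2) ^+ 2 / (1 + t ^+ 2) ^+ 2)).
  by field.
by rewrite (circp : p.1 ^+ 2 + p.2 ^+ 2 = 1) divff ?expf_neq0 ?mulr1.
Qed.

Lemma punctured_circle_continuous : continuous (punctured_circle p).
Proof.
move=> t.
have sq : (x ^+ 2 @[x --> t] --> t ^+ 2).
  by rewrite expr2; under eq_fun do rewrite expr2; apply: cvgM.
have inv : ((1 + x ^+ 2)^-1 @[x --> t] --> (1 + t ^+ 2)^-1).
  by apply: cvgV => //; apply: cvgD => //; exact: cvg_cst.
have tt : (x *+ 2 @[x --> t] --> t *+ 2) by apply: cvgMn; exact: cvg_id.
have om : ((1 - x ^+ 2) @[x --> t] --> (1 - t ^+ 2)).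
  by apply: cvgB => //; exact: cvg_cst.
have c (k l : R) : ((k * (1 - x ^+ 2) + l * (x *+ 2)) / (1 + x ^+ 2) @[x --> t] -->
    (k * (1 - t ^+ 2) + l * (t *+ 2)) / (1 + t ^+ 2)).
  by apply: cvgM => //; apply: cvgD; apply: cvgM => //; exact: cvg_cst.
exact: cvg_pair (c (- p.1) (- p.2)) (c (- p.2) p.1).
Qed.

Lemma chord_sign_continuous s : continuous (chord_sign p s).
Proof.
move=> q.
have c1 : x.1 @[x --> q] --> q.1 by exact: cvg_fst.
have c2 : x.2 @[x --> q] --> q.2 by exact: cvg_snd.
have cc (k : R) (F : set_system (R * R)) : Filter F -> (fun=> k) @ F --> k.
  by move=> FF; exact: cvg_cst.
apply: cvgB; first by apply: cvgB; apply: cvgM => //; exact: cc.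
apply: cvgM; first exact: cc.
apply: cvgB; first exact: cc.
by apply: cvgD; apply: cvgM => //; exact: cc.
Qed.

Lemma chord_sign_base s : chord_sign p s p = 0.
Proof. by rewrite /chord_sign -!expr2 pE; ring. Qed.

Lemma chord_sign_param s t :
  chord_sign p s (punctured_circle p t) = (t - s) * (2 / (1 + t ^+ 2)).
Proof.
transitivity ((p.1 ^+ 2 + p.2 ^+ 2) * (t *+ 2 / (1 + t ^+ 2))
   - s * (1 - (p.1 ^+ 2 + p.2 ^+ 2) * ((t ^+ 2 - 1) / (1 + t ^+ 2)))).
  by rewrite /chord_sign /=; field.
by rewrite (circp : p.1 ^+ 2 + p.2 ^+ 2 = 1); field.
Qed.

Lemma punctured_circle_neq t : punctured_circle p t != p.
Proof.
apply/eqP => tp; have := chord_sign_param (t - 1) t.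
rewrite tp chord_sign_base opprB addrC subrK mul1r => /esym/eqP.
by rewrite mulf_eq0 pnatr_eq0 invr_eq0 (negbTE (d0 t)).
Qed.

Lemma punctured_circle_onto q : unit_circle R q -> q != p ->
  exists t, punctured_circle p t = q.
Proof.
move=> circq qp; set c := p.1 * q.1 + p.2 * q.2; set d := p.1 * q.2 - p.2 * q.1.
have qE : q.1 ^+ 2 + q.2 ^+ 2 = 1 := circq.
have cpE : p.1 ^+ 2 + p.2 ^+ 2 = 1 := circp.
have cd : c ^+ 2 + d ^+ 2 = 1.
  transitivity ((p.1 ^+ 2 + p.2 ^+ 2) * (q.1 ^+ 2 + q.2 ^+ 2)); last first.
    by rewrite qE cpE mulr1.
  by rewrite /c /d; ring.
have c1 : 1 - c != 0.
  apply: contra qp => /eqP c1.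
  have : (q.1 - p.1) ^+ 2 + (q.2 - p.2) ^+ 2 = 0.
    transitivity ((p.1 ^+ 2 + p.2 ^+ 2) + (q.1 ^+ 2 + q.2 ^+ 2) - c *+ 2).
      by rewrite /c; ring.
    rewrite cpE qE; lra.
  move/eqP; rewrite paddr_eq0 ?sqr_ge0 // !sqrf_eq0 !subr_eq0.
  by rewrite [q]surjective_pairing [p]surjective_pairing xpair_eqE.
(* Stereographic projection of [q], with [c] and [d] the cosine and sine of the
   angle from [p] to [q]. *)
exists (d / (1 - c)).
have dE : d ^+ 2 = (1 - c) * (1 + c).
  by have -> : d ^+ 2 = 1 - c ^+ 2; [move: cd; lra|ring].
have tE : (d / (1 - c)) ^+ 2 = (1 + c) / (1 - c).
  by rewrite expr_div_n dE; field.
have plus : 1 + (1 + c) / (1 - c) = 2 / (1 - c) by field.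
have minus : 1 - (1 + c) / (1 - c) = - c *+ 2 / (1 - c) by field.
rewrite /punctured_circle tE plus minus [q]surjective_pairing; congr pair.
- transitivity ((p.1 ^+ 2 + p.2 ^+ 2) * q.1); last by rewrite cpE mul1r.
  transitivity (p.1 * c - p.2 * d); last by rewrite /c /d; ring.
  by field.
- transitivity ((p.1 ^+ 2 + p.2 ^+ 2) * q.2); last by rewrite cpE mul1r.
  transitivity (p.2 * c + p.1 * d); last by rewrite /c /d; ring.
  by field.
Qed.
End PuncturedCircle.

Lemma circle_punctured_line (R : realType) (X : topologicalType) (a : X) :
  simple_closed_curve R X -> exists (gamma : R -> X) (ell : R -> X -> R),
    [/\ continuous gamma, forall t, gamma t <> a,
        forall x, x <> a -> exists t, gamma t = x,
        forall s, continuous (ell s) &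
        forall s, ell s a = 0 /\
          forall t, exists2 c, 0 < c & ell s (gamma t) = (t - s) * c].
Proof.
move=> [f [g [fK gK fc gc]]].
pose phi x := set_val (f x); pose p := phi a.
have circ x : unit_circle R (phi x) by apply: set_mem; exact: (valP (f x)).
have phic : continuous phi.
  by move=> x; apply: continuous_comp; [exact: fc|exact: initial_continuous].
pose pc t : set_type (unit_circle R) := SigSub (mem_set (punctured_circle_in (circ a) t)).
have pcc : continuous pc.
  have pE := @punctured_circle_continuous R p.
  by apply: continuous_comp_initial.
have phig t : phi (g (pc t)) = punctured_circle p t by rewrite /phi gK.
exists (g \o pc), (fun s x => chord_sign p s (phi x)); split.
- by move=> t; apply: continuous_comp; [exact: pcc|exact: gc].
- move=> t e; have /eqP := punctured_circle_neq (circ a) t; apply.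
  by rewrite -phig; exact: (congr1 phi e).
- move=> x xa; have xp : phi x != p.
    apply/eqP => e; apply: xa; apply: (can_inj fK); apply: val_inj; exact: e.
  have [t tE] := punctured_circle_onto (circ a) (circ x) xp.
  exists t; rewrite /= -[RHS]fK; congr g; apply: val_inj; exact: tE.
- move=> s x; apply: (@continuous_comp _ _ _ phi); first exact: phic.
  exact: chord_sign_continuous.
- move=> s; split; first exact: chord_sign_base (circ a) s.
  move=> t; exists (2 / (1 + t ^+ 2)); last first.
    by rewrite /= phig (chord_sign_param (circ a)).
  by rewrite divr_gt0 // ltr_wpDr // sqr_ge0.
Qed.

(** * The characterization *)

(** A subcontinuum avoiding [a] and the point [b] of parameter [s] is confined
    to one side of their chord by the sign of [ell s].  For a point [p], the
    images of segments under [gamma] join any two other points off [p]. *)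
Lemma circle_nonblockers (R : realType) (X : metricType R) :
  continuum X -> simple_closed_curve R X -> nonblockers X = singleton_hyperspace X.
Proof.
move=> [_ cX kX] scX; have hX := @metric_hausdorff _ X.
have closed1 (x : X) : closed [set x].
  exact/accessible_closed_set1/hausdorff_accessible.
apply/seteqP; split=> B.
- move=> [[[[a Ba] clB] BT] nbB].
  have [gamma [ell [gc ga gsurj ellc ellE]]] := circle_punctured_line a scX.
  exists a => //; apply/esym/seteqP; split=> [b Bb|_ -> //].
  apply: contrapT => ba; apply: BT; apply/seteqP; split=> // x _.
  apply: contrapT => nBx.
  have xa : x <> a by move=> xa; rewrite xa in nBx.
  have [s sb] := gsurj b ba; have [t tx] := gsurj x xa.
  have ts : t - s != 0.
    by rewrite subr_eq0; apply/eqP => ts; apply: nBx; rewrite -tx ts sb.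
  have [ella ellg] := ellE s.
  (* The factor makes the side of [x] the positive one. *)
  pose h y := (t - s) * ell s y.
  have hc : continuous h.
    by move=> y; apply: cvgM; [exact: cvg_cst|exact: ellc].
  have hx : 0 < h x.
    have [c c0 e] := ellg t; rewrite /h -tx e mulrA mulr_gt0 //.
    by rewrite -expr2 lt0r sqr_ge0 sqrf_eq0 ts.
  pose P := h @^-1` [set r | 0 < r]; pose N := h @^-1` [set r | r < 0].
  have oP : open P by apply: open_comp => //; exact: open_gt.
  have oN : open N by apply: open_comp => //; exact: open_lt.
  have N0 : N !=set0.
    (* The parameter of [x] reflected in [s]. *)
    exists (gamma (s - (t - s))); have [c c0 e] := ellg (s - (t - s)).
    rewrite /N /= /h e addrAC subrr sub0r mulNr mulrN mulrA oppr_lt0 mulr_gt0 //.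
    by rewrite -expr2 lt0r sqr_ge0 sqrf_eq0 ts.
  have [z [Nz [C [[C0 clC cC] Cx CB] Cz]]] := nbB x nBx N N0 oN.
  have CP : C `<=` P.
    apply: (connected_open_cover cC oP oN).
    + move=> y Cy; have ya : y <> a by move=> ya; apply: (CB y Cy); rewrite ya.
      have [u uy] := gsurj y ya; have [c c0 e] := ellg u.
      have us : u - s != 0.
        by rewrite subr_eq0; apply/eqP => us; apply: (CB y Cy); rewrite -uy us sb.
      have : h y != 0 by rewrite /h -uy e !mulf_neq0 // gt_eqF.
      by rewrite neq_lt => /orP[]; [right|left].
    + by apply/seteqP; split=> // y [[_ Py] Ny]; have := lt_trans Py Ny; rewrite ltxx.
    + by exists x.
  by have := lt_trans (CP z Cz) Nz; rewrite ltxx.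
- move=> [p _ <-].
  have [gamma [ell [gc gp gsurj _ _]]] := circle_punctured_line p scX.
  have pT : [set p] <> setT.
    by move=> pT; apply: (gp 0); have : setT (gamma 0) by []; rewrite -pT.
  split; first by split=> //; split=> //; exists p.
  move=> x xp O [y0 Oy0] oO.
  have [y [Oy yp]] : exists y, O y /\ y <> p.
    apply: contrapT => noy; apply: (pT).
    have Op y : O y -> y = p.
      by move=> Oy; apply: contrapT => yp; apply: noy; exists y.
    have OE : O = [set p].
      apply/seteqP; split=> y; first exact: Op.
      by move=> ->; rewrite -(Op _ Oy0).
    by apply: (clopen_setT kX); [rewrite -OE|exact: closed1|exists p].
  have [t tx] := gsurj x xp; have [u uy] := gsurj y yp.
  pose C := gamma @` `[Num.min t u, Num.max t u]%classic.
  have cC : subcontinuum C.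
    split; first by exists (gamma t), t => //=; rewrite in_itv /= ge_min lexx le_max lexx.
      apply: compact_closed => //; apply: continuous_compact; last exact: segment_compact.
      exact: continuous_subspaceT.
    apply: connected_continuous_connected; last exact: continuous_subspaceT.
    exact: segment_connected.
  exists y; split=> //; exists C.
    split=> //; first by exists t => //=; rewrite in_itv /= ge_min lexx le_max lexx.
    by move=> _ [v _ <-] /= /gp.
  by exists u => //=; rewrite in_itv /= ge_min lexx le_max lexx !orbT.
Qed.

Lemma nonblockers_circle (R : realType) (X : metricType R) :
  continuum X -> nonblockers X = singleton_hyperspace X ->
  simple_closed_curve R X.
Proof.
move=> [[a _] cX kX] NB.
have single p : nonblockers X [set p] by rewrite NB; exists p.
have nondeg (p : X) : exists x, x <> p.
  have [[_ pT] _] := single p; apply: contrapT => nox; apply: pT.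
  by apply/seteqP; split=> // x _; apply: contrapT => xp; apply: nox; exists x.
have nb_point p x (O : set X) : x <> p -> open O -> O !=set0 ->
    exists C, [/\ subcontinuum C, C x, ~ C p & C `&` O !=set0].
  move=> xp oO O0; have [_ nb] := single p.
  have [y [Oy [C [cC Cx Cp] Cy]]] := nb x xp O O0 oO.
  by exists C; split=> //; [move=> /Cp; apply|exists y].
have nb_only_point (B : set X) : B !=set0 -> closed B -> ~` B !=set0 ->
    (forall x O, ~ B x -> open O -> O !=set0 ->
      exists C, [/\ subcontinuum C, C x, C `<=` ~` B & C `&` O !=set0]) ->
    exists x, B = [set x].
  move=> B0 clB [y nBy] nb; have [] : singleton_hyperspace X B; last first.
    by move=> x _ <-; exists x.
  rewrite -NB; split; first by split=> // BT; apply: nBy; rewrite BT.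
  move=> x nBx O O0 oO; have [C [cC Cx CB [z [Cz Oz]]]] := nb x O nBx oO O0.
  by exists z; split=> //; exists C.
have [b /nesym ab] := nondeg a.
have [U [V sUV]] := pair_splits cX kX nondeg nb_point nb_only_point ab.
have aV := splits_arclike cX kX nondeg nb_point nb_only_point ab sUV.
have aU := splits_arclike cX kX nondeg nb_point nb_only_point ab (splitsC sUV).
have [_ _ UV SUV _] := sUV.
apply: (circle_of_arcs cX aV aU).
  by rewrite -setCI setIC UV setC0.
by rewrite -setCU setUC -SUV setCK.
Qed.

Theorem theorem5p3 (R : realType) (X : metricType R) (hX : continuum X) :
  simple_closed_curve R X <-> nonblockers X = singleton_hyperspace X.
Proof. by split; [exact: circle_nonblockers|exact: nonblockers_circle]. Qed.
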